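(* Let $(X,\mathcal A)$ and $(X',\mathcal A')$ be orbifolds such that the singular strata of $(X,\mathcal A)$ have codimension at least two. If $f\colon(X,\mathcal A)\to(X',\mathcal A')$ is a smooth map such that $f((X,\mathcal A)^{\mathrm{reg}})\subset(X',\mathcal A')^{\mathrm{reg}}$, then the graph of $f$ is a regular suborbifold of the product orbifold $(X\times X',\mathcal A\times\mathcal A')$.
   Context: Manifolds are smooth, second countable and Hausdorff; submanifolds are embedded; group actions are smooth. **Orbifolds.** Let $X$ be a second countable Hausdorff space. An $n$-dimensional orbifold chart on $X$ is $(U,\widetilde U/\Gamma,\pi)$ with $U\subset X$ open, $\widetilde U$ a connected $n$-manifold, $\Gamma$ a finite group acting smoothly and effectively on $\widetilde U$, and $\pi\colon\widetilde U\to U$ continuous, $\Gamma$-invariant, inducing a homeomorphism $\widetilde U/\Gamma\to U$. For charts with $U_1\subset U_2$, an injection from $\pi_1$ to $\pi_2$ is a smooth embedding $\lambda\colon\widetilde U_1\to\widetilde U_2$ with $\pi_2\circ\lambda=\pi_1$. Two charts are compatible if every $x\in U_1\cap U_2$ lies in some $W\subset U_1\cap U_2$ for a chart $(W,\widetilde W/K,\sigma)$ admitting injections into both. An atlas is a collection of pairwise compatible charts covering $X$; an orbifold $(X,\mathcal A)$ is such an $X$ with a maximal atlas $\mathcal A$. The isotropy of $x\in X$ is the isomorphism class of the stabilizer $\Gamma_{\widetilde x}$ for some (hence every) chart $(U,\widetilde U/\Gamma,\pi)\in\mathcal A$ and $\widetilde x\in\pi^{-1}(x)$. The point $x$ is regular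 if its isotropy is trivial, otherwise singular; $(X,\mathcal A)^{\mathrm{reg}}$ is the set of regular points. That the singular strata have codimension at least two means that in every chart $(U,\widetilde U/\Gamma,\pi)\in\mathcal A$ the fixed point set in $\widetilde U$ of every nontrivial element of $\Gamma$ has all its components of codimension at least two. The product orbifold of $(X,\mathcal A)$ and $(X',\mathcal A')$ is $X\times X'$ with the maximal atlas $\mathcal A\times\mathcal A'$ containing all charts $(U\times U',(\widetilde U\times\widetilde U')/(\Gamma\times\Gamma'),\pi\times\pi')$ with $(U,\widetilde U/\Gamma,\pi)\in\mathcal A$, $(U',\widetilde U'/\Gamma',\pi')\in\mathcal A'$. **Smooth maps.** A smooth map $f\colon(X,\mathcal A)\to(X',\mathcal A')$ is a continuous map $f\colon X\to X'$ such that for each $x\in X$ there are a chart $(U,\widetilde U/\Gamma,\pi)\in\mathcal A$ around $x$, a chart $(U',\widetilde U'/\Gamma',\pi')\in\mathcal A'$ around $f(x)$, a smooth map $\widetilde f\colon\widetilde U\to\widetilde U'$ and a homomorphism $\overline f\colon\Gamma\to\Gamma'$ with $\pi'\circ\widetilde f=f\circ\pi$ and $\widetilde f(\gamma p)=\overline f(\gamma)\widetilde f(p)$ for all $\gamma\in\Gamma$, $p\in\widetilde U$. **Regular suborbifolds.** If a finite group $\Gamma$ acts on a manifold $M$ and $\Delta\subset\Gamma$ is a subgroup, a $\Delta$-invariant submanifold $N\subset M$ is a $\Delta$-submanifold if for all $\gamma\in\Gamma$, $p\in N$ with $\gamma p\in N$ there is $\delta\in\Delta$ with $\delta p=\gamma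 p$. Given an atlas $\{(U_i,\widetilde U_i/\Gamma_i,\pi_i)\}_{i\in I}$ on $X$ and $Y\subset X$, a $k$-dimensional closed suborbifold cover on $Y$ is a subset $J\subset I$ and a family $\{\widetilde V_j\}_{j\in J}$ of connected $k$-manifolds such that for every $j$ the set $\widetilde V_j$ is closed in $\widetilde U_j$ and there is a subgroup $\Delta_j\subset\Gamma_j$ for which $\widetilde V_j$ is a $\Delta_j$-submanifold of $\widetilde U_j$ with $\pi_j(\widetilde V_j)$ open in $Y$, and $\bigcup_j\pi_j(\widetilde V_j)=Y$. It is a regular suborbifold cover if for every $j\in J$ the set $\{p\in\widetilde V_j:(\Gamma_j)_p=\{e\}\}$ is dense in $\widetilde V_j$ and connected. A subset $Y$ of an orbifold $(X,\mathcal A)$ is a regular suborbifold if there is a regular suborbifold cover on $Y$ with respect to some countable atlas contained in $\mathcal A$. *)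

(* Defs.v *)
From HB Require Import structures.
From mathcomp Require Import all_boot all_order all_algebra all_fingroup.
From mathcomp Require Import mathcomp_extra boolp classical_sets functions cardinality.
From mathcomp Require Import reals topology normedtype landau derive.
Set Implicit Arguments.
Unset Strict Implicit.
Unset Printing Implicit Defensive.
Import numFieldNormedType.Exports.
Import Order.TTheory GRing.Theory Num.Theory.
Local Open Scope classical_set_scope.
Local Open Scope ring_scope.

Section SmoothFunctions.
Variables (R : realType) (V W : normedModType R).
Implicit Types (D : set V) (f g : V -> W).

(* Functions are total; for open [D] only their restriction to [D] matters
   (see [class_C_eq]). *)
Fixpoint class_C (k : nat) D f : Prop :=
  match k with
  | 0%N => forall x, D x -> {for x, continuous f}
  | k'.+1 => (forall x, D x -> differentiable f x) /\
             (forall v, class_C k' D (fun x => 'D_v f x))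
  end.

Definition smooth_on D f := forall k, class_C k D f.

Lemma differentiable_near_eq f g x :
  {near x, f =1 g} -> differentiable f x -> differentiable g x.
Proof.
move=> fg df; have fgx : f x = g x := nbhs_singleton fg.
have dc : continuous ('d f x) by exact: diff_continuous.
have H : g \o shift x = cst (g x) + 'd f x +o_ (0 : V) id.
  apply/eqaddoP => e e0.
  have /eqaddoP/(_ e e0) := diff_locally df.
  have fg' : \forall h \near (0 : V), f (h + x) = g (h + x).
    by move: fg; rewrite (near_shift 0) subr0.
  by apply: filterS2 fg' => h /=; rewrite !fctE /= /cst fgx => ->.
apply/diff_locallyP.
have E : 'd g x = 'd f x :> (V -> W) by exact: diff_unique.
by rewrite E.
Qed.

Lemma class_C_eq k D f g : open D -> (forall x, D x -> f x = g x) ->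
  class_C k D f -> class_C k D g.
Proof.
move=> oD; have nD x : D x -> nbhs x D by move=> Dx; exact: open_nbhs_nbhs.
elim: k f g => [|k IH] f g fg /=.
  move=> cf x Dx; have := cf x Dx.
  rewrite /prop_for /continuous_at (fg x Dx); apply: cvg_trans.
  by apply: near_eq_cvg; apply: filterS (nD _ Dx) => y /fg.
move=> [df Cf]; split=> [x Dx|v].
  by apply: differentiable_near_eq (df x Dx); apply: filterS (nD _ Dx) => y /fg.
apply: IH (Cf v) => x Dx; apply: near_eq_derive.
by apply: filterS (nD _ Dx) => y /fg.
Qed.
End SmoothFunctions.

Section RowMx.
Variables (R : realType) (m1 m2 n1 n2 : nat).

Definition row_pair (z : 'rV[R]_n1 * 'rV[R]_n2) : 'rV[R]_(n1 + n2) :=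
  row_mx z.1 z.2.

Fact row_pair_linear : linear row_pair.
Proof. by move=> k x y; rewrite /row_pair /= scale_row_mx add_row_mx. Qed.

HB.instance Definition _ := GRing.isLinear.Build R
  ('rV[R]_n1 * 'rV[R]_n2)%type 'rV[R]_(n1 + n2) *:%R row_pair row_pair_linear.

Lemma row_pair_continuous : continuous row_pair.
Proof.
move=> u A /nbhs_ballP[e /= e0 eA].
apply/nbhs_ballP; exists e => //= v; rewrite /ball/= /prod_ball /ball/= /mx_ball /=.
move=> [[_ uv1] [_ uv2]]; apply: eA; split => // i j.
by rewrite !mxE; case: fintype.split => k; [exact: uv1|exact: uv2].
Qed.

Definition row_prod (a : 'rV[R]_m1 -> 'rV[R]_n1) (b : 'rV[R]_m2 -> 'rV[R]_n2)
  (w : 'rV[R]_(m1 + m2)) : 'rV[R]_(n1 + n2) :=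
  row_mx (a (lsubmx w)) (b (rsubmx w)).

Definition row_dom (D : set 'rV[R]_m1) (E : set 'rV[R]_m2) :=
  [set w : 'rV[R]_(m1 + m2) | D (lsubmx w) /\ E (rsubmx w)].

Lemma row_dom_open D E : open D -> open E -> open (row_dom D E).
Proof.
move=> oD oE; apply: (@openI _ (lsubmx @^-1` D) (rsubmx @^-1` E)).
  by apply: open_comp oD => x _; exact: continuous_lsubmx.
by apply: open_comp oE => x _; exact: continuous_rsubmx.
Qed.

Lemma row_prod_is_diff a b w :
  differentiable a (lsubmx w) -> differentiable b (rsubmx w) ->
  is_diff w (row_prod a b) (row_prod ('d a (lsubmx w)) ('d b (rsubmx w))).
Proof.
move=> da db.
have dl := @differentiable_lsubmx R 1 m1 m2 w.
have dr := @differentiable_rsubmx R 1 m1 m2 w.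
have dal : differentiable (a \o lsubmx) w by exact: differentiable_comp.
have dbr : differentiable (b \o rsubmx) w by exact: differentiable_comp.
have -> : row_prod a b =
    row_pair \o (fun w => ((a \o lsubmx) w, (b \o rsubmx) w)) by [].
have dp : differentiable (fun w => ((a \o lsubmx) w, (b \o rsubmx) w)) w.
  exact: differentiable_pair.
have dJ : forall z, differentiable row_pair z.
  by move=> z; apply: linear_differentiable; exact: row_pair_continuous.
apply: DiffDef; first exact: differentiable_comp.
apply/funext => v.
rewrite diff_comp//= diff_lin; last exact: row_pair_continuous.
rewrite diff_pair// /row_pair /row_prod /=.
rewrite (diff_comp dl da) (diff_comp dr db) /=.
by rewrite diff_lin ?diff_lin //; [exact: continuous_rsubmx|exact: continuous_lsubmx].
Qed.

Lemma class_C_row_prod k D E a b : open D -> open E ->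
  class_C k D a -> class_C k E b -> class_C k (row_dom D E) (row_prod a b).
Proof.
move=> oD oE; elim: k a b => [|k IH] a b /=.
  move=> ca cb w [Dw Ew].
  have cl : {for w, continuous (a \o lsubmx)}.
    by apply: continuous_comp; [exact: continuous_lsubmx|exact: ca].
  have cr : {for w, continuous (b \o rsubmx)}.
    by apply: continuous_comp; [exact: continuous_rsubmx|exact: cb].
  apply: (@continuous_comp _ _ _ (fun w => (a (lsubmx w), b (rsubmx w))) row_pair);
    last exact: row_pair_continuous.
  exact: cvg_pair cl cr.
move=> [da Ca] [db Cb]; split=> [w [Dw Ew]|v].
  by have [] := row_prod_is_diff (da _ Dw) (db _ Ew).
apply: (@class_C_eq _ _ _ _ _
  (row_prod (fun x => 'D_(lsubmx v) a x) (fun x => 'D_(rsubmx v) b x))).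
- exact: row_dom_open.
- move=> w [Dw Ew]; have [d e] := row_prod_is_diff (da _ Dw) (db _ Ew).
  rewrite deriveE// e /row_prod deriveE; last exact: da.
  by rewrite deriveE//; exact: db.
- exact: IH.
Qed.

End RowMx.

Section ProductTopology.
Variables M N : topologicalType.

Lemma open_setX (A : set M) (B : set N) : open A -> open B -> open (A `*` B).
Proof.
move=> oA oB; apply: (@openI _ (fst @^-1` A) (snd @^-1` B)).
  by apply: open_comp oA => x _; exact: cvg_fst.
by apply: open_comp oB => x _; exact: cvg_snd.
Qed.

Lemma open_prodP (O : set (M * N)) z : open O -> O z ->
  exists A B, [/\ open A, open B, A z.1, B z.2 & A `*` B `<=` O].
Proof.
rewrite openE => oO /oO [[P Q] [/= nP nQ] PQ].
exists P°, Q°; split; [exact: open_interior|exact: open_interior|exact: nP|exact: nQ|].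
by move=> w [/interior_subset Pw /interior_subset Qw]; exact: PQ.
Qed.

Lemma openP_prod (O : set (M * N)) :
  (forall z, O z -> exists A B, [/\ open A, open B, A z.1, B z.2 & A `*` B `<=` O]) ->
  open O.
Proof.
move=> H; rewrite openE => z /H [A [B [oA oB Az Bz AB]]].
exists (A, B); last by [].
by split; apply: open_nbhs_nbhs.
Qed.

Lemma hausdorff_prod :
  hausdorff_space M -> hausdorff_space N -> hausdorff_space (M * N)%type.
Proof.
move=> hM hN [x y] [x' y'] H; congr pair.
  apply: hM => A B nA nB.
  have [] := H (A `*` setT) (B `*` setT).
  - by exists (A, setT) => //; split => //; exact: filterT.
  - by exists (B, setT) => //; split => //; exact: filterT.
  by move=> [u v] [[/= ? _] [/= ? _]]; exists u.
apply: hN => A B nA nB.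
have [] := H (setT `*` A) (setT `*` B).
- by exists (setT, A) => //; split => //; exact: filterT.
- by exists (setT, B) => //; split => //; exact: filterT.
by move=> [u v] [[/= _ ?] [/= _ ?]]; exists v.
Qed.

Lemma second_countable_prod : @second_countable M -> @second_countable N ->
  @second_countable (M * N)%type.
Proof.
move=> [A cA [oA bA]] [B cB [oB bB]].
exists ((fun z => z.1 `*` z.2) @` (A `*` B)).
  by apply: sub_countable (card_image_le _ _) _; exact: countableX.
split=> [_ [[U V] [/= /oA oU /oB oV] <-]|[x y] O [[P Q] [/= nP nQ] PQ]].
  exact: open_setX.
have [U [/= AU Ux] UP] := bA x P nP; have [V [/= BV Vy] VQ] := bB y Q nQ.
exists (U `*` V).
  by split => //=; exists (U, V).
by move=> z [/UP ? /VQ ?]; exact: PQ.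
Qed.

Lemma connected_prod : connected [set: M] -> connected [set: N] ->
  connected [set: M * N].
Proof.
move=> cM cN.
have [[[x0 y0] _]|] := pselect ([set: M * N] !=set0); last first.
  by move=> /nonemptyPn ->; exact: connected0.
have cX x : connected [set (x, y) | y in [set: N]].
  apply: connected_continuous_connected cN _; apply: continuous_subspaceT => y.
  by apply: cvg_pair; [exact: cvg_cst|exact: cvg_id].
have cY : connected [set (x, y0) | x in [set: M]].
  apply: connected_continuous_connected cM _; apply: continuous_subspaceT => y.
  by apply: cvg_pair; [exact: cvg_id|exact: cvg_cst].
rewrite (_ : setT = \bigcup_(x in [set: M])
  ([set (x, y) | y in [set: N]] `|` [set (x, y0) | x in [set: M]])).
  apply: bigcup_connected => [|x _].
    by exists (x0, y0) => x _; right; exists x0.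
  apply: connectedU => //; exists (x, y0); split; [by exists y0|by exists x].
by apply/seteqP; split=> [[x y] _|//]; exists x => //; left; exists y.
Qed.

End ProductTopology.

Section Manifolds.
Variable R : realType.

(* A homeomorphism from the open set [cdom] onto an open subset of R^n; the
   values of [cmap] outside [cdom] are irrelevant. *)
Record coord_chart (n : nat) (M : topologicalType) := CoordChart {
  cdom : set M ;
  cmap :> M -> 'rV[R]_n ;
  cdom_open : open cdom ;
  cmap_inj : forall x y, cdom x -> cdom y -> cmap x = cmap y -> x = y ;
  cmap_continuous : forall x, cdom x -> {for x, continuous cmap} ;
  cmap_open : forall O, open O -> O `<=` cdom -> open (cmap @` O)
}.

(* [g] is smooth and represents [psi \o f \o phi^-1] on its domain. *)
Definition local_rep m n (M N : topologicalType) (phi : coord_chart m M)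
    (psi : coord_chart n N) (f : M -> N) (g : 'rV[R]_m -> 'rV[R]_n) :=
  smooth_on (phi @` (cdom phi `&` f @^-1` cdom psi)) g /\
  forall x, cdom phi x -> cdom psi (f x) -> g (phi x) = psi (f x).

(* The smooth structure is given by an atlas that need not be maximal: every
   notion below only depends on the maximal atlas it generates. The empty
   manifold is allowed. *)
Record manifold (n : nat) := Manifold {
  mspace :> topologicalType ;
  mspace_hausdorff : hausdorff_space mspace ;
  mspace_second_countable : @second_countable mspace ;
  matlas : set (coord_chart n mspace) ;
  matlas_cover : forall x, exists2 phi, matlas phi & cdom phi x ;
  matlas_compat : forall phi psi, matlas phi -> matlas psi ->
    exists g, local_rep phi psi id g
}.

Definition smooth_map m n (M : manifold m) (N : manifold n) (f : M -> N) :=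
  continuous f /\
  forall phi psi, matlas phi -> matlas psi -> exists g, local_rep phi psi f g.

Definition immersion m n (M : manifold m) (N : manifold n) (f : M -> N) :=
  smooth_map f /\
  forall phi psi g, matlas phi -> matlas psi -> local_rep phi psi f g ->
    forall x, cdom phi x -> cdom psi (f x) -> injective ('d g (phi x)).

Definition smooth_embedding m n (M : manifold m) (N : manifold n) (f : M -> N) :=
  [/\ immersion f, injective f &
      forall O : set M, open O -> exists2 O', open O' & O = f @^-1` O'].

(* [A] is an embedded submanifold of dimension [k]: with the subspace topology,
   it has a smooth structure of dimension [k] for which the inclusion is a
   smooth embedding. The [k]-manifold [V] is [A] itself up to the bijection
   [i]. *)
Definition submanifold k n (M : manifold n) (A : set M) :=
  exists (V : manifold k) (i : V -> M), smooth_embedding i /\ range i = A.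

End Manifolds.

Section ProductManifold.
Variable R : realType.

Definition prod_map (A B C D : Type) (f : A -> B) (g : C -> D) (z : A * C) :=
  (f z.1, g z.2).

Lemma prod_map_continuous (A B C D : topologicalType) (f : A -> B) (g : C -> D) :
  continuous f -> continuous g -> continuous (prod_map f g).
Proof.
move=> cf cg z; have cf' : {for z, continuous (f \o fst)}.
  by apply: continuous_comp; [exact: cvg_fst|exact: cf].
have cg' : {for z, continuous (g \o snd)}.
  by apply: continuous_comp; [exact: cvg_snd|exact: cg].
exact: cvg_pair cf' cg'.
Qed.

Section ProductChart.
Variables (m n : nat) (M N : topologicalType).
Variables (phi : coord_chart R m M) (psi : coord_chart R n N).

Let pdom := cdom phi `*` cdom psi.
Let pmap (z : M * N) := row_mx (phi z.1) (psi z.2).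

Fact prod_chart_inj x y : pdom x -> pdom y -> pmap x = pmap y -> x = y.
Proof.
case: x y => [x x'] [y y'] [/= dx dx'] [/= dy dy'] /eq_row_mx [/= E E'].
by congr pair; [apply: cmap_inj E|apply: cmap_inj E'].
Qed.

Fact prod_chart_continuous x : pdom x -> {for x, continuous pmap}.
Proof.
move=> [dx dx'].
have cf : {for x, continuous (phi \o fst)}.
  by apply: continuous_comp; [exact: cvg_fst|exact: cmap_continuous].
have cg : {for x, continuous (psi \o snd)}.
  by apply: continuous_comp; [exact: cvg_snd|exact: cmap_continuous].
apply: (@continuous_comp _ _ _ (prod_map phi psi) (@row_pair R m n));
  last exact: row_pair_continuous.
exact: cvg_pair cf cg.
Qed.

Fact prod_chart_open O : open O -> O `<=` pdom -> open (pmap @` O).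
Proof.
move=> oO Od; rewrite openE => _ [z Oz <-].
have [A [B [oA oB Az Bz AB]]] := open_prodP oO Oz.
have [dz dz'] := Od _ Oz.
pose A' := A `&` cdom phi; pose B' := B `&` cdom psi.
have oA' : open (phi @` A').
  by apply: cmap_open; [apply: openI => //; exact: cdom_open|move=> x []].
have oB' : open (psi @` B').
  by apply: cmap_open; [apply: openI => //; exact: cdom_open|move=> x []].
apply: (@filterS _ _ _ (row_dom (phi @` A') (psi @` B'))); last first.
  apply: open_nbhs_nbhs; split; first exact: row_dom_open.
  by split; rewrite ?row_mxKl ?row_mxKr; [exists z.1|exists z.2].
move=> w [[x [Ax _] Ex] [y [By _] Ey]]; exists (x, y); first exact: AB.
by rewrite /pmap /= Ex Ey hsubmxK.
Qed.

Definition prod_chart : coord_chart R (m + n) (M * N)%type :=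
  CoordChart (open_setX (cdom_open phi) (cdom_open psi))
    prod_chart_inj prod_chart_continuous prod_chart_open.

End ProductChart.

Lemma local_rep_dom_open m n (M N : topologicalType) (phi : coord_chart R m M)
    (psi : coord_chart R n N) (f : M -> N) : continuous f ->
  open (phi @` (cdom phi `&` f @^-1` cdom psi)).
Proof.
move=> cf; apply: cmap_open; last by move=> x [].
apply: openI; first exact: cdom_open.
by apply: open_comp; [move=> x _; exact: cf|exact: cdom_open].
Qed.

Section ProductMap.
Variables (m n m' n' : nat) (M N M' N' : topologicalType).
Variables (phi : coord_chart R m M) (psi : coord_chart R n N).
Variables (phi' : coord_chart R m' M') (psi' : coord_chart R n' N').
Variables (f : M -> N) (f' : M' -> N').
Hypotheses (cf : continuous f) (cf' : continuous f').

Lemma local_rep_prod g g' : local_rep phi psi f g -> local_rep phi' psi' f' g' ->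
  local_rep (prod_chart phi phi') (prod_chart psi psi') (prod_map f f')
    (row_prod g g').
Proof.
move=> [sg Eg] [sg' Eg']; split=> [k|[x x'] [/= dx dx'] [/= ex ex']]; last first.
  by rewrite /row_prod row_mxKl row_mxKr Eg// Eg'.
rewrite (_ : image _ _ = row_dom (phi @` (cdom phi `&` f @^-1` cdom psi))
    (phi' @` (cdom phi' `&` f' @^-1` cdom psi'))).
  by apply: class_C_row_prod; do ?exact: local_rep_dom_open; [exact: sg|exact: sg'].
apply/seteqP; split=> [_ [[x x'] [[/= dx dx'] [/= ex ex']] <-]|w].
  by split; rewrite ?row_mxKl ?row_mxKr; [exists x|exists x'].
move=> [[x [dx ex] Ex] [x' [dx' ex'] Ex']]; exists (x, x') => //=.
by rewrite Ex Ex' hsubmxK.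
Qed.

Lemma local_rep_prod_inj g g' h x x' :
  local_rep phi psi f g -> local_rep phi' psi' f' g' ->
  local_rep (prod_chart phi phi') (prod_chart psi psi') (prod_map f f') h ->
  cdom phi x -> cdom psi (f x) -> cdom phi' x' -> cdom psi' (f' x') ->
  injective ('d g (phi x)) -> injective ('d g' (phi' x')) ->
  injective ('d h (row_mx (phi x) (phi' x'))).
Proof.
move=> rg rg' rh dx ex dx' ex' ig ig'; have [sg _] := rg; have [sg' _] := rg'.
set w := row_mx _ _.
have dg : differentiable g (lsubmx w).
  by rewrite row_mxKl; apply: (sg 1%N).1; exists x.
have dg' : differentiable g' (rsubmx w).
  by rewrite row_mxKr; apply: (sg' 1%N).1; exists x'.
have [dG EG] := row_prod_is_diff dg dg'.
have E : {near w, row_prod g g' =1 h}.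
  have o := @local_rep_dom_open _ _ _ _ (prod_chart phi phi') (prod_chart psi psi')
    _ (prod_map_continuous cf cf').
  apply: filterS (open_nbhs_nbhs (conj o _)); last by exists (x, x').
  move=> _ [z [dz ez] <-].
  by rewrite (local_rep_prod rg rg').2// rh.2.
have dh := differentiable_near_eq E dG.
move=> u v; rewrite -!deriveE// -!(near_eq_derive _ E) !deriveE// EG.
move=> /eq_row_mx []; rewrite row_mxKl row_mxKr => /ig El /ig' Er.
by rewrite -[u]hsubmxK El Er hsubmxK.
Qed.

End ProductMap.

Section ProductManifold.
Variables (m n : nat) (M : manifold R m) (N : manifold R n).

Definition prod_matlas : set (coord_chart R (m + n) (M * N)%type) :=
  [set c | exists phi psi, [/\ matlas phi, matlas psi & c = prod_chart phi psi]].

Fact prod_matlas_cover x : exists2 c, prod_matlas c & cdom c x.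
Proof.
have [phi ? ?] := matlas_cover x.1; have [psi ? ?] := matlas_cover x.2.
by exists (prod_chart phi psi) => //; exists phi, psi.
Qed.

Fact prod_matlas_compat c d : prod_matlas c -> prod_matlas d ->
  exists g, local_rep c d id g.
Proof.
move=> [phi [psi [aphi apsi ->]]] [phi' [psi' [aphi' apsi' ->]]].
have [g rg] := matlas_compat aphi aphi'; have [h rh] := matlas_compat apsi apsi'.
exists (row_prod g h); rewrite (_ : id = prod_map id id); last first.
  by apply/funext => -[].
by apply: local_rep_prod => // x; exact: cvg_id.
Qed.

Definition prod_manifold : manifold R (m + n) := Manifold
  (hausdorff_prod (@mspace_hausdorff _ _ M) (@mspace_hausdorff _ _ N))
  (second_countable_prod (@mspace_second_countable _ _ M)
     (@mspace_second_countable _ _ N))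
  prod_matlas_cover prod_matlas_compat.

End ProductManifold.

Section ProductEmbedding.
Variables (m n m' n' : nat) (M : manifold R m) (N : manifold R n).
Variables (M' : manifold R m') (N' : manifold R n').
Variables (f : M -> N) (f' : M' -> N').

Lemma smooth_map_prod : smooth_map f -> smooth_map f' ->
  @smooth_map R _ _ (prod_manifold M M') (prod_manifold N N') (prod_map f f').
Proof.
move=> [cf sf] [cf' sf']; split; first exact: prod_map_continuous.
move=> _ _ [phi [phi' [a a' ->]]] [psi [psi' [b b' ->]]].
have [g rg] := sf _ _ a b; have [g' rg'] := sf' _ _ a' b'.
by exists (row_prod g g'); exact: local_rep_prod.
Qed.

Lemma smooth_embedding_prod : smooth_embedding f -> smooth_embedding f' ->
  @smooth_embedding R _ _ (prod_manifold M M') (prod_manifold N N')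
    (prod_map f f').
Proof.
move=> [[sf df] jf tf] [[sf' df'] jf' tf']; split.
- split; first exact: smooth_map_prod.
  move=> _ _ h [phi [phi' [a a' ->]]] [psi [psi' [b b' ->]]] rh [x x'].
  move=> [/= dx dx'] [/= ex ex'].
  have [g rg] := sf.2 _ _ a b; have [g' rg'] := sf'.2 _ _ a' b'.
  apply: (local_rep_prod_inj sf.1 sf'.1 rg rg' rh) => //.
    exact: df rg _ _ _.
  exact: df' rg' _ _ _.
- by move=> [x x'] [y y'] [/jf -> /jf' ->].
- move=> O oO.
  pose P (U : set (N * N')) := open U /\ prod_map f f' @^-1` U `<=` O.
  exists (\bigcup_(U in P) U); first by apply: bigcup_open => U [].
  apply/seteqP; split=> [z Oz|z [U [_]]]; last by apply.
  have [A [B [oA oB Az Bz AB]]] := open_prodP oO Oz.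
  have [A' oA' EA] := tf _ oA; have [B' oB' EB] := tf' _ oB.
  exists (A' `*` B').
    split; first exact: open_setX.
    by move=> w [/= wA wB]; apply: AB; split; rewrite ?EA ?EB.
  by move: Az Bz; rewrite EA EB.
Qed.

End ProductEmbedding.
End ProductManifold.

(* An orbifold chart contains a topological space and a finite group, so the
   type of charts lives in a universe above the one of [set], where the Zorn
   lemmas of the library do not apply. The case needed here (a family of
   pairwise related elements is contained in a maximal one) is proved below,
   for predicates instead of sets. *)
Section MaximalClique.
Variables (C : Type) (r : C -> C -> Prop) (S : C -> Prop).

Definition clique (A : C -> Prop) := forall c d, A c -> A d -> r c d.

Let sub (A B : C -> Prop) := forall c, A c -> B c.
Let add (A : C -> Prop) c := fun d => A d \/ d = c.
Let next (A : C -> Prop) : C -> Prop :=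
  if pselect (exists c, ~ A c /\ clique (add A c)) is left e
  then add A (projT1 (cid e)) else A.

Let chain_union (F : (C -> Prop) -> Prop) c := S c \/ exists2 A, F A & A c.

Inductive clique_tower : (C -> Prop) -> Prop :=
| CTnext A : clique_tower A -> clique_tower (next A)
| CTunion (F : (C -> Prop) -> Prop) :
    (forall A, F A -> clique_tower A) -> clique_tower (chain_union F).

Let sub_next A : sub A (next A).
Proof. by rewrite /next /sub => c Ac; case: pselect => [e|//]; left. Qed.

Let tower_base A : clique_tower A -> sub S A.
Proof.
by elim=> [{}A _ SA c Sc|F _ _ c]; [exact/sub_next/SA|left].
Qed.

Let tower_total A B : clique_tower A -> clique_tower B ->
  sub A B \/ sub B A.
Proof.
pose rel X Y := sub X Y \/ sub (next Y) X.
have union F Y : clique_tower Y -> (forall X, F X -> rel X Y) ->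
    rel (chain_union F) Y.
  move=> tY FY; have [H|H] := pselect (exists2 X, F X & sub (next Y) X).
    by right; case: H => X FX sX c /sX; right; exists X.
  left=> c [/(tower_base tY)//|[X FX Xc]].
  by case: (FY _ FX) => [|sX]; [exact|case: H; exists X].
have step X Y : rel X Y -> rel Y X -> rel (next X) Y.
  case=> [XY|YX _]; last by right=> c /YX /sub_next.
  case=> [YX|]; last by left.
  right; suff -> : X = Y by [].
  by apply/predeqP => c; split; [exact: XY|exact: YX].
have rel_tower X : clique_tower X -> forall Y, clique_tower Y -> rel X Y.
  elim=> [X1 tX IHX Y tY|F _ IH Y tY]; last by apply: union => // Z /IH; exact.
  apply: (step); first exact: IHX.
  elim: tY => [Y1 tY IHY|G tG IH]; last exact: union.
  by apply: step => //; exact: IHX.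
move=> tA tB; have [?|BA] := rel_tower _ tA _ tB; first by left.
by right=> c /sub_next /BA.
Qed.

Lemma clique_maximal_ext : clique S -> exists A, [/\ clique A,
  (forall c, S c -> A c) &
  forall B, clique B -> (forall c, A c -> B c) -> forall c, B c -> A c].
Proof.
move=> cS; have tower_clique A : clique_tower A -> clique A.
  elim=> [A1 _ cA|F tF cF c d].
    by rewrite /next; case: pselect => // e; case: (projT2 (cid e)).
  move=> [Sc|[A1 FA Ac]] [Sd|[B1 FB Bd]].
  - exact: cS.
  - by apply: (cF B1 FB) => //; exact: (tower_base (tF _ FB)).
  - by apply: (cF A1 FA) => //; exact: (tower_base (tF _ FA)).
  - have [AB|BA] := tower_total (tF _ FA) (tF _ FB).
      by apply: (cF B1 FB) => //; exact: AB.
    by apply: (cF A1 FA) => //; exact: BA.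
have tU : clique_tower (chain_union clique_tower) by exact: CTunion.
exists (chain_union clique_tower); split; [exact: tower_clique|by left|].
move=> B cB UB c Bc; apply: contrapT => Uc.
have ex : exists c, ~ chain_union clique_tower c /\
    clique (add (chain_union clique_tower) c).
  by exists c; split=> // x y [/UB ?|->] [/UB ?|->]; exact: cB.
have nU d : next (chain_union clique_tower) d -> chain_union clique_tower d.
  by move=> nd; right; exists (next (chain_union clique_tower)) => //; exact: CTnext.
move: nU; rewrite /next; case: pselect => // e.
by move/(_ (projT1 (cid e)) (or_intror erefl)); case: (projT2 (cid e)).
Qed.

End MaximalClique.

Section Orbifolds.
Variable R : realType.

(* Left action of [ogrp] on [ocov]. The last three fields say that [oproj]
   induces a bijection from the orbit space onto [odom] and that the topology
   of [odom] is the quotient topology: with [oproj_continuous], the induced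
   bijection is a homeomorphism. A connected manifold is nonempty by convention;
   for an empty [ocov], effectiveness of the actions would not be inherited by
   product charts. *)
Record orb_chart (n : nat) (X : topologicalType) := OrbChart {
  odom : set X ;
  ocov : manifold R n ;
  ogrp : finGroupType ;
  oact : ogrp -> ocov -> ocov ;
  oproj : ocov -> X ;
  odom_open : open odom ;
  ocov_nonempty : [set: ocov] !=set0 ;
  ocov_connected : connected [set: ocov] ;
  oact1 : forall p, oact 1%g p = p ;
  oactM : forall g h p, oact (g * h)%g p = oact g (oact h p) ;
  oact_smooth : forall g, smooth_map (oact g) ;
  oact_effective : forall g, (forall p, oact g p = p) -> g = 1%g ;
  oproj_continuous : continuous oproj ;
  oproj_range : range oproj = odom ;
  oproj_orbit : forall p q, oproj p = oproj q <-> exists g, q = oact g p ;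
  oproj_quotient : forall O, O `<=` odom -> open (oproj @^-1` O) -> open O
}.

Global Arguments oproj {n X} o p.
Global Arguments ocov_nonempty {n X} o.
Global Arguments ocov_connected {n X} o.

Definition trivial_stabilizer n X (c : orb_chart n X) (p : ocov c) :=
  forall g : ogrp c, oact g p = p -> g = 1%g.

Definition fixed_set n X (c : orb_chart n X) (g : ogrp c) : set (ocov c) :=
  [set p | oact g p = p].

Definition orb_injection n X (c1 c2 : orb_chart n X) (l : ocov c1 -> ocov c2) :=
  [/\ odom c1 `<=` odom c2, smooth_embedding l &
      forall p, oproj c2 (l p) = oproj c1 p].

Definition orb_compatible n X (c1 c2 : orb_chart n X) :=
  forall x, odom c1 x -> odom c2 x ->
  exists d : orb_chart n X,
    [/\ odom d x, odom d `<=` odom c1 `&` odom c2,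
        exists l : ocov d -> ocov c1, orb_injection l &
        exists l : ocov d -> ocov c2, orb_injection l].

Definition orb_atlas n (X : topologicalType) (A : orb_chart n X -> Prop) :=
  (forall c d, A c -> A d -> orb_compatible c d) /\
  (forall x, exists2 c, A c & odom c x).

(* All charts of an [n]-dimensional orbifold have dimension [n], and maximality
   is among atlases of [n]-dimensional charts. *)
Record orbifold (n : nat) := Orbifold {
  ospace :> topologicalType ;
  ospace_hausdorff : hausdorff_space ospace ;
  ospace_second_countable : @second_countable ospace ;
  oatlas : orb_chart n ospace -> Prop ;
  oatlas_atlas : orb_atlas oatlas ;
  oatlas_maximal : forall B : orb_chart n ospace -> Prop, orb_atlas B ->
    (forall c, oatlas c -> B c) -> forall c, B c -> oatlas c
}.

(* Stabilizers over the same point are isomorphic for all charts, so that one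
   chart suffices to determine the isotropy. *)
Definition regular_points n (X : orbifold n) : set X :=
  [set x | exists c (p : ocov c),
    [/\ oatlas c, oproj c p = x & trivial_stabilizer p]].

Global Arguments regular_points {n} X _.

Definition singular_codim_ge2 n (X : orbifold n) :=
  forall c : orb_chart n X, oatlas c ->
  forall g : ogrp c, g <> 1%g -> forall p, fixed_set g p ->
  exists2 k, (k + 2 <= n)%N & submanifold k (connected_component (fixed_set g) p).

Definition orb_smooth m n (X : orbifold m) (Y : orbifold n) (f : X -> Y) :=
  continuous f /\
  forall x, exists (c : orb_chart m X) (d : orb_chart n Y),
    [/\ oatlas c, odom c x, oatlas d, odom d (f x) &
      exists (ft : ocov c -> ocov d) (fb : ogrp c -> ogrp d),
        [/\ smooth_map ft,
            {morph fb : g h / (g * h)%g >-> (g * h)%g},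
            forall p, oproj d (ft p) = f (oproj c p) &
            forall g p, ft (oact g p) = oact (fb g) (ft p)]].

(* [N] is a [D]-submanifold of [ocov c] of dimension [k]. *)
Definition sub_submanifold k n X (c : orb_chart n X) (D : {group ogrp c})
    (N : set (ocov c)) :=
  [/\ submanifold k N,
      forall d p, d \in D -> N p -> N (oact d p) &
      forall g p, N p -> N (oact g p) -> exists2 d, d \in D & oact d p = oact g p].

(* [c] is an indexed atlas; [V i] is irrelevant for [i] outside [J]. *)
Definition closed_suborbifold_cover k n (X : topologicalType) (I : Type)
    (c : I -> orb_chart n X) (Y : set X) (J : set I)
    (V : forall i, set (ocov (c i))) :=
  (forall j, J j ->
    [/\ V j !=set0 /\ connected (V j), closed (V j),
        exists D : {group ogrp (c j)}, sub_submanifold k D (V j) &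
        exists2 O, open O & oproj (c j) @` V j = Y `&` O]) /\
  \bigcup_(j in J) (oproj (c j) @` V j) = Y.

Definition regular_suborbifold_cover k n (X : topologicalType) (I : Type)
    (c : I -> orb_chart n X) (Y : set X) (J : set I)
    (V : forall i, set (ocov (c i))) :=
  closed_suborbifold_cover k Y J V /\
  forall j, J j ->
    let W := V j `&` [set p | trivial_stabilizer p] in
    V j `<=` closure W /\ connected W.

Definition regular_suborbifold n (X : orbifold n) (Y : set X) :=
  exists (I : Type) (c : I -> orb_chart n X),
    [/\ countable [set: I], forall i, oatlas (c i),
        orb_atlas (fun d => exists i, d = c i) &
        exists k J V, @regular_suborbifold_cover k n X I c Y J V].

Lemma orb_atlas_maximal_ext n (X : topologicalType) (S : orb_chart n X -> Prop) :
  orb_atlas S -> exists A, [/\ orb_atlas A, forall c, S c -> A c &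
    forall B, orb_atlas B -> (forall c, A c -> B c) -> forall c, B c -> A c].
Proof.
move=> [cS covS]; have [A [cA SA mA]] := clique_maximal_ext cS.
exists A; split=> //; last by move=> B [cB _]; exact: mA.
by split=> // x; have [c /SA] := covS x; exists c.
Qed.

Lemma oproj_open n X (c : orb_chart n X) (B : set (ocov c)) :
  open B -> open (oproj c @` B).
Proof.
move=> oB; apply: (@oproj_quotient _ _ c).
  by rewrite -oproj_range => _ [p _ <-]; exists p.
rewrite (_ : _ @^-1` _ = \bigcup_(g in [set: ogrp c]) (oact g @^-1` B)).
  apply: bigcup_open => g _; apply: open_comp oB => p _.
  exact: (oact_smooth g).1.
apply/seteqP; split=> [p [q Bq /esym /oproj_orbit [g E]]|p [g _ Bg]].
  by exists g => //=; rewrite -E.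
by exists (oact g p) => //; apply/esym/oproj_orbit; exists g.
Qed.

Section ProductChart.
Variables (m n : nat) (X Y : topologicalType).
Variables (c : orb_chart m X) (d : orb_chart n Y).

Let pcov := prod_manifold (ocov c) (ocov d).
Let pgrp : finGroupType := (ogrp c * ogrp d)%type.
Let pact (g : pgrp) : pcov -> pcov := prod_map (oact g.1) (oact g.2).
Let pproj : pcov -> X * Y := prod_map (oproj c) (oproj d).

Fact prod_orb_nonempty : [set: pcov] !=set0.
Proof.
have [p _] := ocov_nonempty c; have [q _] := ocov_nonempty d.
by exists (p, q).
Qed.

Fact prod_orb_act1 p : pact 1%g p = p.
Proof. by case: p => p q; rewrite /pact /prod_map /= !oact1. Qed.

Fact prod_orb_actM g h p : pact (g * h)%g p = pact g (pact h p).
Proof. by rewrite /pact /prod_map /= !oactM. Qed.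

Fact prod_orb_act_smooth g : smooth_map (pact g).
Proof. by apply: smooth_map_prod; exact: oact_smooth. Qed.

Fact prod_orb_effective g : (forall p, pact g p = p) -> g = 1%g.
Proof.
have [p0 _] := ocov_nonempty c; have [q0 _] := ocov_nonempty d.
case: g => g h H; congr pair; apply: oact_effective => p.
  by have [] := H (p, q0).
by have [] := H (p0, p).
Qed.

Fact prod_orb_proj_continuous : continuous pproj.
Proof. by apply: prod_map_continuous; exact: oproj_continuous. Qed.

Fact prod_orb_range : range pproj = odom c `*` odom d.
Proof.
rewrite -!oproj_range; apply/seteqP; split=> [_ [p _ <-]|[x y] [[p _ /= <-] [q _ /= <-]]].
  by split; [exists p.1|exists p.2].
by exists (p, q).
Qed.

Fact prod_orb_orbit p q : pproj p = pproj q <-> exists g, q = pact g p.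
Proof.
case: p q => [p p'] [q q']; split=> [[/oproj_orbit [g ->] /oproj_orbit [h ->]]|].
  by exists (g, h).
move=> [[g h] [-> ->]]; congr pair; apply/oproj_orbit; first by exists g.
by exists h.
Qed.

Fact prod_orb_quotient O : O `<=` odom c `*` odom d -> open (pproj @^-1` O) -> open O.
Proof.
move=> Od oO; apply: openP_prod => z Oz.
have := Od _ Oz; rewrite -prod_orb_range => -[p _ pz].
have Op : (pproj @^-1` O) p by rewrite /= pz.
have [A [B [oA oB Ap Bp AB]]] := open_prodP oO Op.
exists (oproj c @` A), (oproj d @` B).
split; [exact: oproj_open|exact: oproj_open| | |].
- by rewrite -pz; exists p.1.
- by rewrite -pz; exists p.2.
- by move=> [x y] [[q Aq /= <-] [r Br /= <-]]; exact: (AB (q, r)).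
Qed.

Definition prod_orb_chart : orb_chart (m + n) (X * Y)%type :=
  @OrbChart (m + n) (X * Y)%type (odom c `*` odom d) pcov pgrp pact pproj
    (open_setX (odom_open c) (odom_open d))
    prod_orb_nonempty
    (connected_prod (ocov_connected c) (ocov_connected d))
    prod_orb_act1 prod_orb_actM prod_orb_act_smooth prod_orb_effective
    prod_orb_proj_continuous prod_orb_range prod_orb_orbit prod_orb_quotient.

End ProductChart.

Section ProductOrbifold.
Variables (m n : nat) (X : orbifold m) (Y : orbifold n).

Definition prod_orb_charts (e : orb_chart (m + n) (X * Y)%type) :=
  exists c d, [/\ oatlas c, oatlas d & e = prod_orb_chart c d].

Lemma orb_injection_prod (c1 c2 : orb_chart m X) (d1 d2 : orb_chart n Y) l l' :
  @orb_injection _ _ c1 c2 l -> @orb_injection _ _ d1 d2 l' ->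
  @orb_injection _ _ (prod_orb_chart c1 d1) (prod_orb_chart c2 d2)
    (prod_map l l').
Proof.
move=> [s e E] [s' e' E']; split.
- by move=> [x y] [/s ? /s' ?].
- exact: smooth_embedding_prod.
- by move=> [p q] /=; congr pair; [exact: E|exact: E'].
Qed.

Lemma prod_orb_charts_atlas : orb_atlas prod_orb_charts.
Proof.
split=> [_ _ [c [d [Ac Ad ->]]] [c' [d' [Ac' Ad' ->]]]|[x y]]; last first.
  have [c ? ?] := (oatlas_atlas X).2 x; have [d ? ?] := (oatlas_atlas Y).2 y.
  by exists (prod_orb_chart c d) => //; exists c, d.
move=> [x y] [/= cx dy] [/= cx' dy'].
have [w [wx wc [l il] [l' il']]] := (oatlas_atlas X).1 _ _ Ac Ac' x cx cx'.
have [v [vy vd [k ik] [k' ik']]] := (oatlas_atlas Y).1 _ _ Ad Ad' y dy dy'.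
exists (prod_orb_chart w v); split => //.
- by move=> [x' y'] [/= /wc [? ?] /vd [? ?]].
- by exists (prod_map l k); exact: orb_injection_prod.
- by exists (prod_map l' k'); exact: orb_injection_prod.
Qed.

(* The product charts form an atlas, hence are contained in a maximal one. It is
   unique since compatibility of charts is transitive, so that the choice made
   by [cid] is immaterial. *)
Definition prod_oatlas : orb_chart (m + n) (X * Y)%type -> Prop :=
  projT1 (cid (orb_atlas_maximal_ext prod_orb_charts_atlas)).

Lemma prod_oatlasP : [/\ orb_atlas prod_oatlas, forall e, prod_orb_charts e -> prod_oatlas e &
  forall B, orb_atlas B -> (forall e, prod_oatlas e -> B e) ->
    forall e, B e -> prod_oatlas e].
Proof. exact: (projT2 (cid (orb_atlas_maximal_ext prod_orb_charts_atlas))). Qed.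

Fact prod_oatlas_atlas : orb_atlas prod_oatlas.
Proof. by have [] := prod_oatlasP. Qed.

Fact prod_oatlas_maximal B : orb_atlas B ->
  (forall e, prod_oatlas e -> B e) -> forall e, B e -> prod_oatlas e.
Proof. by have [_ _] := prod_oatlasP; apply. Qed.

Definition prod_orbifold : orbifold (m + n) := Orbifold
  (hausdorff_prod (@ospace_hausdorff _ X) (@ospace_hausdorff _ Y))
  (second_countable_prod (@ospace_second_countable _ X)
     (@ospace_second_countable _ Y))
  prod_oatlas_atlas prod_oatlas_maximal.

End ProductOrbifold.
End Orbifolds.

(* Main.v *)
(* The suborbifold charts of the graph are the graphs of the local lifts [h] of
   [f], inside products of charts, with the graph of the homomorphism [hb] acting
   on them. Such a chart point has trivial stabilizer iff its first component
   does, since [f] preserves regular points and regularity does not depend on the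
   chart. So it remains to see that the points with trivial stabilizer form a
   connected dense subset of each chart of [X]. Near a point, averaging over its
   stabilizer (and the inverse function theorem) makes the stabilizer act
   linearly; the singular points then form a finite union of linear subspaces, of
   codimension at least two by hypothesis, whose complement in a ball is connected
   and dense. The same linearization shows that a group element fixing a nonempty
   open set is trivial, which yields the independence of the chart. *)

Require Import Defs.
From HB Require Import structures.
From mathcomp Require Import all_boot all_order all_algebra all_fingroup.
From mathcomp Require Import mathcomp_extra boolp classical_sets functions cardinality.
From mathcomp Require Import reals topology normedtype landau derive.
From mathcomp Require Import interval_inference sequences.
From mathcomp Require Import ring lra.
Set Implicit Arguments.
Unset Strict Implicit.
Unset Printing Implicit Defensive.
Import numFieldNormedType.Exports.
Import Order.TTheory GRing.Theory Num.Theory.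
Local Open Scope classical_set_scope.
Local Open Scope ring_scope.

(** * Strict differentiability of maps of class C^1 *)

Section Calculus.
Variable R : realType.

Lemma mx_entry_le m n (A : 'M[R]_(m, n)) i j : `|A i j| <= `|A|.
Proof.
rewrite [leRHS]/Num.Def.normr /= mx_normrE.
exact: (le_bigmax _ (fun ij => `|A ij.1 ij.2|) (i, j)).
Qed.

Lemma mx_norm_le m n (A : 'M[R]_(m, n)) e : 0 <= e ->
  (forall i j, `|A i j| <= e) -> `|A| <= e.
Proof.
move=> e0 Ae; rewrite /Num.Def.normr /= mx_normrE.
by apply: bigmax_le => // -[i j] _; exact: Ae.
Qed.

(** Strong Fréchet differentiability: both points vary. For additive [L] this says that [f - L] has
    arbitrarily small Lipschitz constants near [a], which is what the fixed point argument for local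
    inversion uses. *)
Definition strict_diff (V W : normedModType R) (f : V -> W) (a : V) (L : V -> W) :=
  forall e, 0 < e -> exists2 d, 0 < d & forall u v, ball a d u -> ball a d v ->
    `|f u - f v - L (u - v)| <= e * `|u - v|.

Lemma line_is_derive (V W : normedModType R) (f : V -> W) (v w : V) t :
  differentiable f (v + t *: w) ->
  is_derive (t : R) 1 (fun s : R => f (v + s *: w)) ('D_w f (v + t *: w)).
Proof.
move=> /diff_derivable - /(_ w) df.
have E : (fun h : R => h^-1 *: (((fun s : R => f (v + s *: w)) \o shift t) (h *: 1)
             - f (v + t *: w))) =
         (fun h : R => h^-1 *: ((f \o shift (v + t *: w)) (h *: w) - f (v + t *: w))).
  apply/funext => h /=; congr (_ *: (f _ - _)).
  by rewrite [h *: 1]mulr1 scalerDl addrCA.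
by apply: DeriveDef; [rewrite /derivable E|rewrite /derive E].
Qed.

(** The mean value theorem is applied to each coordinate along the segment from [v] to [u]; the
    derivative along [w] is a combination of partial derivatives, and these are continuous at
    [a]. *)
Lemma class_C1_strict m n (D : set 'rV[R]_m) (f : 'rV[R]_m -> 'rV[R]_n) (a : 'rV[R]_m) :
  open D -> class_C 1 D f -> D a -> strict_diff f a ('d f a).
Proof.
move=> oD [/= df cf] Da e e0.
(* Each of the [m] partial derivatives contributes an error of at most [e']; dividing by [m.+1] also
   covers [m = 0]. *)
pose e' := e / m.+1%:R.
have e'0 : 0 < e' by rewrite divr_gt0.
have : \forall x \near a, D x /\
    forall j : 'I_m, `|'D_(delta_mx 0 j) f x - 'D_(delta_mx 0 j) f a| <= e'.
  apply: filterI; first exact: open_nbhs_nbhs.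
  apply: (@filter_forall _ 'I_m (fun j x =>
    `|'D_(delta_mx 0 j) f x - 'D_(delta_mx 0 j) f a| <= e') (nbhs a) _) => j.
  by have /cvgrPdistC_le/(_ _ e'0) := cf (delta_mx 0 j) a Da.
move=> /nbhs_ballP[d /= d0 dP]; exists d => // u v au av.
set w := u - v.
have bt (t : R) : t \in `[0, 1]%R -> ball a d (v + t *: w).
  rewrite in_itv /= => /andP[t0 t1].
  move: au av; rewrite -!ball_normE /= => au av.
  have -> : a - (v + t *: w) = t *: (a - u) + (1 - t) *: (a - v).
    by rewrite /w !scalerBr !scalerBl !scale1r; apply/rowP => i; rewrite !mxE; ring.
  apply: le_lt_trans (ler_normD _ _) _; rewrite !normrZ ger0_norm// ger0_norm ?subr_ge0//.
  have [->|t0'] := eqVneq t 0; first by rewrite mul0r add0r subr0 mul1r.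
  have tp : 0 < t by rewrite lt_neqAle eq_sym t0'.
  rewrite (_ : d = t * d + (1 - t) * d); last by ring.
  by apply: ltr_leD; [rewrite ltr_pM2l|rewrite ler_wpM2l ?subr_ge0// ltW].
apply: mx_norm_le => [|i j]; first by rewrite mulr_ge0// ltW.
rewrite {i}(ord1 i).
pose h (t : R) : R := f (v + t *: w) 0 j.
pose dh (t : R) : R := ('D_w f (v + t *: w)) 0 j.
have hd (t : R) : t \in `[0, 1]%R -> is_derive t 1 h (dh t).
  move=> /bt /dP[Dt _]; have := line_is_derive (df _ Dt) => -[ex E].
  apply: DeriveDef; first by have /derivable_mxP := ex; exact.
  by move: E; rewrite (derive_mx ex) /dh => <-; rewrite mxE.
have hd' (x : R) : x \in `]0, 1[%R -> is_derive x 1 h (dh x).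
  by move=> x01; apply: hd; exact: subset_itv_oo_cc x01.
have hc : {within `[0, 1], continuous h}.
  apply: derivable_within_continuous => x x01.
  by have [] := hd x x01.
have [c c01 E] := @MVT_segment R h dh 0 1 ler01 hd' hc.
have Dc := dP _ (bt _ c01).
have -> : (f u - f v - 'd f a w) 0 j = ('D_w f (v + c *: w) - 'D_w f a) 0 j.
  have sE (A B : 'rV[R]_n) : (A - B) 0 j = A 0 j - B 0 j by rewrite !mxE.
  have Ed : dh c = h 1 - h 0 by rewrite E subr0 mulr1.
  rewrite !sE -/(dh c) Ed /h scale1r scale0r addr0 /w subrKC deriveE//.
  exact: df.
apply: le_trans (mx_entry_le _ _ _) _.
have -> : 'D_w f (v + c *: w) - 'D_w f a =
    \sum_k w 0 k *: ('D_(delta_mx 0 k) f (v + c *: w) - 'D_(delta_mx 0 k) f a).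
  have Ew x : D x -> 'D_w f x = \sum_k w 0 k *: 'D_(delta_mx 0 k) f x.
    move=> /df dfx; rewrite (deriveEjacobian _ dfx) mulmx_sum_row.
    by apply: eq_bigr => k _; rewrite (deriveEjacobian _ dfx) -rowE.
  rewrite (Ew _ Dc.1) (Ew _ Da) -sumrB.
  by apply: eq_bigr => k _; rewrite -scalerBr.
apply: le_trans (ler_norm_sum _ _ _) _.
have -> : e * `|w| = m.+1%:R * (e' * `|w|).
  by rewrite /e' mulrA [_ * (e / _)]mulrC divfK// pnatr_eq0.
apply: (@le_trans _ _ (\sum_(k < m) (e' * `|w|))).
  apply: ler_sum => k _; rewrite normrZ mulrC.
  by apply: ler_pM => //; [exact: Dc.2|exact: mx_entry_le].
by rewrite sumr_const card_ord -[leLHS]mulr_natl ler_wpM2r// ?ler_nat// mulr_ge0// ltW.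
Qed.
End Calculus.

Section StrictDifferentiability.
Variable R : realType.

Lemma strict_diff_lin (V W W' : normedModType R) (A : {linear W -> W'}) (f : V -> W) a L :
  continuous A -> strict_diff f a L -> strict_diff (A \o f) a (A \o L).
Proof.
move=> /linear_lipschitz[k k0 Ak] sf e e0.
have [d d0 H] := sf (e / k) (divr_gt0 e0 k0).
exists d => // u v /= au av; rewrite -!linearB.
apply: le_trans (Ak _) _; rewrite -ler_pdivlMl// mulrA [_^-1 * e]mulrC.
exact: H.
Qed.

Lemma strict_diffD (V W : normedModType R) (f g : V -> W) a L M :
  strict_diff f a L -> strict_diff g a M -> strict_diff (f + g) a (L + M).
Proof.
move=> sf sg e e0; have e2 : 0 < e / 2 by rewrite divr_gt0.
have [d d0 H] := sf _ e2; have [d' d'0 H'] := sg _ e2.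
exists (Num.min d d') => [|u v]; first by rewrite lt_min d0.
have le x : ball a (Num.min d d') x -> ball a d x /\ ball a d' x.
  by move=> ax; split; apply: le_ball ax; rewrite ge_min lexx ?orbT.
move=> /le[ud ud'] /le[vd vd']; rewrite !fctE.
have -> : f u + g u - (f v + g v) - (L (u - v) + M (u - v)) =
  (f u - f v - L (u - v)) + (g u - g v - M (u - v)).
  by rewrite !opprD [X in X + _ = _]addrACA [LHS]addrACA.
apply: le_trans (ler_normD _ _) _; rewrite [e]splitr mulrDl.
by apply: lerD; [exact: H|exact: H'].
Qed.

Lemma strict_diff_sum (V W : normedModType R) (I : finType) (P : pred I)
    (f L : I -> V -> W) a :
  (forall i, P i -> strict_diff (f i) a (L i)) ->
  strict_diff (\sum_(i | P i) f i) a (\sum_(i | P i) L i).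
Proof.
move=> sf; elim/big_ind2: _ => [e e0|f1 L1 f2 L2|//]; last exact: strict_diffD.
by exists 1 => // u v _ _; rewrite /= !subrr normr0 mulr_ge0// ltW.
Qed.

End StrictDifferentiability.

Lemma continuous_near_dist (R : realType) (V W : normedModType R) (f : V -> W) x :
  (forall e, 0 < e -> \forall y \near x, `|f x - f y| <= e) -> {for x, continuous f}.
Proof. by move=> H; apply/cvgrPdist_le => e /H. Qed.

(** * Local inversion of maps strictly tangent to the identity *)

Section InverseFunction.
Variables (R : realType) (n : nat).

Section NearIdentity.
Variables (F : 'rV[R]_n -> 'rV[R]_n) (a : 'rV[R]_n) (d : R).
Hypothesis nearF : forall u v, ball a d u -> ball a d v ->
  `|F u - F v - (u - v)| <= 2^-1 * `|u - v|.

Lemma near_id_expand u v : ball a d u -> ball a d v -> `|u - v| <= 2 * `|F u - F v|.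
Proof.
move=> au av; have H := nearF au av.
have : `|u - v| <= `|F u - F v| + `|F u - F v - (u - v)|.
  by rewrite -{1}[u - v](subKr (F u - F v)) ler_normB.
by move: H; lra.
Qed.

Lemma near_id_inj u v : ball a d u -> ball a d v -> F u = F v -> u = v.
Proof.
move=> au av E; apply/eqP; rewrite -subr_eq0 -normr_le0.
by apply: le_trans (near_id_expand au av) _; rewrite E subrr normr0 mulr0.
Qed.

Lemma near_id_continuous u : ball a d u -> {for u, continuous F}.
Proof.
move=> au; apply: continuous_near_dist => e e0.
have oB : open (ball a d) by exact: ball_open.
have nu : nbhs u (ball a d `&` ball u (e / 2)).
  by apply: filterI; [exact: open_nbhs_nbhs|apply: nbhsx_ballx; rewrite divr_gt0].
apply: (@filterS _ _ (nbhs_filter u) _ _ _ nu) => v [av]; rewrite -ball_normE /= => uv.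
have H := nearF au av.
have : `|F u - F v| <= `|F u - F v - (u - v)| + `|u - v|.
  by rewrite -{1}[F u - F v](subrK (u - v)) ler_normD.
by move: H uv; lra.
Qed.

(** A solution of [F v = y] is a fixed point of [v - F v + y]. This map contracts by one half and
    preserves the closed ball of radius [r] about [u]: half of [r] goes to the contraction, half to
    [y - F u]. *)
Lemma near_id_surj u r y : ball a d u -> 0 < r ->
  (forall v, `|v - u| <= r -> ball a d v) -> `|y - F u| <= r / 2 ->
  exists2 v, `|v - u| <= r & F v = y.
Proof.
move=> au r0 ur yr.
pose U : set 'rV[R]_n := [set v | `|v - u| <= r].
pose K v := v - F v + y.
have KU : {homo K : v / U v >-> U v}.
  move=> v Uv; have Hv := nearF (ur _ Uv) au.
  rewrite /U /K /=; have -> : v - F v + y - u = - (F v - F u - (v - u)) + (y - F u).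
    by apply/rowP => i; rewrite !mxE; ring.
  apply: le_trans (ler_normD _ _) _; rewrite normrN.
  by move: Uv yr Hv; rewrite /U /=; lra.
pose k : {fun U >-> U} := HB.pack K (isFun.Build _ _ U U K KU).
have cK : is_contraction k.
  exists (2^-1)%:nng; split; first by rewrite /=; lra.
  move=> [v w] [/= Uv Uw]; rewrite /K.
  have -> : v - F v + y - (w - F w + y) = - (F v - F w - (v - w)).
    by apply/rowP => i; rewrite !mxE; ring.
  by rewrite normrN; exact: nearF (ur _ Uv) (ur _ Uw).
have cU : closed U.
  have -> : U = closed_ball_ Num.norm u r.
    by apply/seteqP; split=> v; rewrite /U /closed_ball_ /= distrC.
  exact: closed_closed_ball_.
pose rVc := HB.pack_for (completeNormedModType R) 'rV[R]_n
  (Complete.class ('rV[R]_n : completeType)).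
have [|v Uv E] := @banach_fixed_point R rVc U k cK cU.
  by exists u; rewrite /U /= subrr normr0 ltW.
exists v => //.
move: E; rewrite /= /K => /eqP; rewrite -subr_eq0 => /eqP E.
apply/eqP; rewrite -subr_eq0 -E; apply/eqP/rowP => i; rewrite !mxE; ring.
Qed.

Lemma near_id_open O : open O -> O `<=` ball a d -> open (F @` O).
Proof.
move=> oO Oa; rewrite openE => _ [u Ou <-].
have : nbhs u O by exact: open_nbhs_nbhs.
move=> /nbhs_ballP[e /= e0 ue].
have e2 : 0 < e / 2 by rewrite divr_gt0.
have sub v : `|v - u| <= e / 2 -> O v.
  by move=> vu; apply: ue; rewrite -ball_normE /= distrC; move: vu; lra.
apply/nbhs_ballP; exists (e / 2 / 2) => /=; first by rewrite divr_gt0.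
move=> y; rewrite -ball_normE /= distrC => /ltW yu.
have [v vu <-] := near_id_surj (Oa _ Ou) e2 (fun v H => Oa _ (sub v H)) yu.
by exists v => //; exact: sub.
Qed.
End NearIdentity.

Lemma strict_diff_id F a : strict_diff F a (@id 'rV[R]_n) ->
  exists2 d, 0 < d & forall u v, ball a d u -> ball a d v ->
  `|F u - F v - (u - v)| <= 2^-1 * `|u - v|.
Proof. by apply; rewrite invr_gt0. Qed.

End InverseFunction.

(* Locked because unification of distinct differentials unfolds them without end. *)
HB.lock Definition jac (R : realType) m n (f : 'rV[R]_m -> 'rV[R]_n) (a : 'rV[R]_m) :
  'M[R]_(m, n) := lin1_mx ('d f a).

(** * Linear coordinates for the action of a stabilizer *)

Section Linearization.
Variable R : realType.

Lemma mulmxr_continuous m n (A : 'M[R]_(m, n)) :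
  continuous (mulmxr A : 'rV[R]_m -> 'rV[R]_n).
Proof.
move=> x; apply: continuous_near_dist => e e0.
(* The summand 1 keeps this Lipschitz constant positive, so that one can divide by it. *)
pose k : R := m%:R * `|A| + 1.
have k0 : 0 < k by rewrite ltr_wpDl// mulr_ge0.
apply/nbhs_ballP; exists (e / k); first by rewrite /= divr_gt0.
move=> y; rewrite -ball_normE /= => /ltW xy.
rewrite -mulmxBl; apply: (@le_trans _ _ (k * `|x - y|)); last by rewrite mulrC -ler_pdivlMr.
apply: (@le_trans _ _ (m%:R * `|A| * `|x - y|)); last by rewrite ler_wpM2r// lerDl.
apply: mx_norm_le => [|i j]; first by rewrite !mulr_ge0.
rewrite mxE; apply: le_trans (ler_norm_sum _ _ _) _.
apply: (@le_trans _ _ (\sum_(k < m) (`|A| * `|x - y|))); last first.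
  by rewrite sumr_const card_ord -[leLHS]mulr_natl mulrA.
apply: ler_sum => l _; rewrite normrM mulrC.
by apply: ler_pM => //; exact: mx_entry_le.
Qed.

Lemma diff_jac m n (f : 'rV[R]_m -> 'rV[R]_n) (a w : 'rV[R]_m) :
  w *m jac f a = 'd f a w :> 'rV[R]_n.
Proof. by rewrite jac.unlock mul_rV_lin1. Qed.

Lemma derive_jac m n (f : 'rV[R]_m -> 'rV[R]_n) (a w : 'rV[R]_m) :
  differentiable f a -> 'D_w f a = w *m jac f a.
Proof. by move=> /deriveE ->; rewrite diff_jac. Qed.

Lemma eq_mulmx_row m n (A B : 'M[R]_(m, n)) : (forall w : 'rV_m, w *m A = w *m B) -> A = B.
Proof. by move=> H; apply/row_matrixP => i; rewrite !rowE. Qed.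

Lemma near_eq_jac m n (f g : 'rV[R]_m -> 'rV[R]_n) (a : 'rV[R]_m) :
  (\forall x \near a, f x = g x) -> differentiable f a -> jac f a = jac g a.
Proof.
move=> fg df; have dg := differentiable_near_eq fg df.
apply: eq_mulmx_row => w.
exact: etrans (etrans (esym (derive_jac w df)) (near_eq_derive w fg)) (derive_jac w dg).
Qed.

Lemma jac_id n (a : 'rV[R]_n) : jac id a = 1%:M.
Proof.
have -> : jac id a = jac (mulmxr 1%:M) a.
  by congr (jac _ a); apply/funext => v; rewrite /= mulmx1.
apply: eq_mulmx_row => w; rewrite diff_jac.
by rewrite diff_lin//; exact: mulmxr_continuous.
Qed.

Lemma jac_comp k m n (f : 'rV[R]_k -> 'rV[R]_m) (g : 'rV[R]_m -> 'rV[R]_n)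
    (a : 'rV[R]_k) :
  differentiable f a -> differentiable g (f a) ->
  jac (g \o f) a = jac f a *m jac g (f a).
Proof.
move=> df dg; apply: eq_mulmx_row => w.
by rewrite mulmxA !diff_jac (diff_comp df dg).
Qed.

Lemma open_setI_preimage (T U : topologicalType) (f : T -> U) O B :
  open O -> (forall x, O x -> {for x, continuous f}) -> open B ->
  open (O `&` f @^-1` B).
Proof.
move=> oO cf oB; rewrite openE => x [Ox Bx]; apply: filterI.
  by apply: open_nbhs_nbhs.
by apply: (cf x Ox); apply: open_nbhs_nbhs.
Qed.

Lemma near_neq (S T : topologicalType) (f g : S -> T) x : hausdorff_space T ->
  {for x, continuous f} -> {for x, continuous g} -> f x <> g x ->
  \forall s \near x, f s <> g s.
Proof.
rewrite open_hausdorff => hT cf cg /eqP /hT [[U V] /= [fU gV] [oU oV /eqP UV]].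
move: fU gV; rewrite !inE => fU gV.
have nU : nbhs x (f @^-1` U) by apply: cf; exact: open_nbhs_nbhs.
have nV : nbhs x (g @^-1` V) by apply: cg; exact: open_nbhs_nbhs.
apply: filterS2 nU nV => s /= Us Vs E.
by have : set0 (f s) by rewrite -UV; split=> //; rewrite E.
Qed.

Lemma local_rep_class m n (M N : topologicalType) (phi : coord_chart R m M)
    (psi : coord_chart R n N) f r x : continuous f -> local_rep phi psi f r ->
  cdom phi x -> cdom psi (f x) ->
  differentiable r (phi x) /\ strict_diff r (phi x) ('d r (phi x)).
Proof.
move=> cf [sr _] dx ex.
have Dx : (phi @` (cdom phi `&` f @^-1` cdom psi)) (phi x) by exists x.
split; first by have [+ _] := sr 1%N; apply.
exact: class_C1_strict (local_rep_dom_open (phi := phi) (psi := psi) cf) (sr 1%N) Dx.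
Qed.

Lemma chart_nbhs n (M : topologicalType) (chi : coord_chart R n M) p (P : set M) :
  cdom chi p -> nbhs p P -> \forall u \near chi p, exists2 x, P x /\ cdom chi x & chi x = u.
Proof.
move=> dp /nbhs_interior nP; pose O := P° `&` cdom chi.
have oO : open (chi @` O).
  apply: cmap_open; last by move=> x [].
  by apply: openI; [exact: open_interior|exact: cdom_open].
have Oa : (chi @` O) (chi p) by exists p => //; split=> //; exact: nbhs_singleton nP.
apply: (@filterS _ _ (nbhs_filter (chi p)) _ _ _ (open_nbhs_nbhs (conj oO Oa))).
by move=> _ [x [Px dx] <-]; exists x => //; split=> //; exact: interior_subset.
Qed.

Section AtPoint.
Variables (n : nat) (X : topologicalType) (c : orb_chart R n X) (p : ocov c).
Variable chi : coord_chart R n (ocov c).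
Hypotheses (achi : matlas chi) (dp : cdom chi p).
Variable r : ogrp c -> 'rV[R]_n -> 'rV[R]_n.
Hypothesis rP : forall g, local_rep chi chi (oact g) (r g).

Let a := chi p.
Let J g := jac (r g) a.
Let G : pred (ogrp c) := [pred g | `[< oact g p = p >]].
Let act_cont (g : ogrp c) : continuous (oact g) := (oact_smooth g).1.

Let GP g : G g -> oact g p = p. Proof. by move/asboolP. Qed.

Let G1 : G 1%g. Proof. by apply/asboolP; rewrite oact1. Qed.

Let GM g h : G h -> G (g * h)%g = G g.
Proof. by move=> /GP hp; apply: asbool_equiv_eq; rewrite oactM hp. Qed.

Let GV g : G g -> G g^-1%g.
Proof. by move=> Gg; rewrite -(GM _ Gg) mulVg. Qed.

Let ra g : G g -> r g a = a.
Proof. by move=> /GP gp; rewrite (rP g).2// gp. Qed.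

Let rdiff g : G g -> differentiable (r g) a.
Proof.
by move=> /GP gp; have [] := local_rep_class (@act_cont g) (rP g) dp;
  rewrite ?gp.
Qed.

Let rstrict g : G g -> strict_diff (r g) a ('d (r g) a).
Proof.
by move=> /GP gp; have [] := local_rep_class (@act_cont g) (rP g) dp;
  rewrite ?gp.
Qed.

Let nearG (g : ogrp c) : G g -> nbhs p (oact g @^-1` cdom chi).
Proof.
by move=> /GP gp; apply: act_cont; rewrite gp; apply: open_nbhs_nbhs; split=> //;
  exact: cdom_open.
Qed.

(** Chain rule at the common fixed point [a]. Matrices act on row vectors from the right, which
    reverses the order. *)
Let JM g h : G g -> G h -> J (g * h)%g = J h *m J g.
Proof.
move=> Gg Gh; have -> : J g = jac (r g) (r h a) by rewrite ra.
rewrite -jac_comp; [|exact: rdiff|].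
  apply: near_eq_jac; last by apply: rdiff; rewrite GM.
  have Ggh : G (g * h)%g by rewrite GM.
  have nx := chart_nbhs dp (@filterI _ _ (nbhs_filter p) _ _ (nearG Gh) (nearG Ggh)).
  apply: (@filterS _ _ (nbhs_filter a) _ _ _ nx) => _ [x [[hx ghx] dx] <-] /=.
  by rewrite (rP (g * h)%g).2// (rP h).2// (rP g).2// -?oactM.
by rewrite ra//; exact: rdiff.
Qed.

Let J1 : J 1%g = 1%:M.
Proof.
rewrite -(jac_id a); apply: near_eq_jac; last exact: rdiff.
have nx := chart_nbhs dp (nearG G1).
apply: (@filterS _ _ (nbhs_filter a) _ _ _ nx) => _ [x [_ dx] <-].
by rewrite (rP 1%g).2 ?oact1.
Qed.

Let N : R := #|G|%:R.
Let N0 : N != 0.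
Proof. by rewrite pnatr_eq0 -lt0n; apply/card_gt0P; exists 1%g. Qed.

Let A g := N^-1 *: J g^-1%g.

(* Averaging [u |-> d(g^-1) (g u - p)] over the stabilizer makes it act
   linearly: [F (g u) = dg (F u)]. *)
Let F : 'rV[R]_n -> 'rV[R]_n :=
  \sum_(g | G g) (mulmxr (A g) \o (fun u => r g u - a)).

Let FE u : F u = \sum_(g | G g) (r g u - a) *m A g.
Proof. by rewrite /F fct_sumE. Qed.

Let F0 : F a = 0.
Proof. by rewrite FE big1// => g Gg; rewrite ra// subrr mul0mx. Qed.

(** Each summand has derivative [J g *m A g], which is [N^-1] times the identity by [JM], and there
    are [N] summands. *)
Let Fstrict : strict_diff F a id.
Proof.
have -> : id = \sum_(g | G g) (mulmxr (A g) \o 'd (r g) a).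
  apply/funext => w; rewrite fct_sumE /=.
  rewrite (eq_bigr (fun=> N^-1 *: w)) => [|g Gg].
    by rewrite sumr_const -scaler_nat scalerA mulfV// scale1r.
  rewrite -diff_jac -mulmxA -scalemxAr -/(J g) -JM ?GV// mulVg J1.
  by rewrite -scalemxAr mulmx1.
apply: strict_diff_sum => g Gg; apply: strict_diff_lin.
  exact: mulmxr_continuous.
move=> e e0; have [d d0 H] := rstrict Gg e0; exists d => // u v du dv.
by have := H u v du dv; rewrite opprB addrA subrK.
Qed.

(** The average is reindexed along right multiplication by [g]. The domain conditions are there
    because [r h] represents the action of [h] only at points of [cdom chi] whose image stays in
    [cdom chi]. *)
Let F_act g x : G g -> cdom chi (oact g x) ->
    (forall h, G h -> cdom chi (oact h (oact g x))) ->
    cdom chi x -> (forall h, G h -> cdom chi (oact h x)) ->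
  F (chi (oact g x)) = F (chi x) *m J g.
Proof.
move=> Gg dgx dhgx dx dhx; rewrite !FE mulmx_suml.
rewrite [RHS](reindex_inj (mulIg g)) [RHS](eq_bigl G) => [|h]; last exact: GM.
apply: eq_bigr => h Gh.
rewrite (rP h).2//; last exact: dhgx.
rewrite (rP (h * g)%g).2//; last by apply: dhx; rewrite GM.
rewrite oactM -mulmxA; congr (_ *m _).
rewrite /A -scalemxAl; congr (_ *: _).
by rewrite -JM ?GV ?GM// invMg mulgA mulgV mul1g.
Qed.

(** The chart [phi] is a restriction of [F \o chi] and serves only as a topological chart. Its
    relation to the smooth chart [chi], through a map strictly tangent to the identity, is recorded
    so that tangent spaces can be compared later. *)
Lemma linearization_at : exists (phi : coord_chart R n (ocov c)) (F : 'rV[R]_n -> 'rV[R]_n),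
  [/\ cdom phi p /\ phi p = 0,
      exists2 e, 0 < e & phi @` cdom phi = ball 0 e,
      [/\ cdom phi `<=` cdom chi, forall x, phi x = F (chi x) &
          strict_diff F a id],
      forall g : ogrp c, oact g p = p -> exists K : 'M[R]_n,
        forall x, cdom phi x -> oact g x = x <-> phi x *m K = 0 &
      forall g : ogrp c, oact g p <> p -> forall x, cdom phi x -> oact g x <> x].
Proof.
have [d d0 nF] := strict_diff_id Fstrict.
pose near_p x := cdom chi x /\ ball a d (chi x).
(* Elements of the stabilizer keep [x] where [chi] is defined and [F] is injective; all others move
   [x]. As the group is finite, this holds near [p]. *)
pose P x := near_p x /\ forall g, if G g then near_p (oact g x) else oact g x <> x.
have nnear : nbhs p near_p.
  apply: filterI; first by apply: open_nbhs_nbhs; split=> //; exact: cdom_open.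
  by apply: (cmap_continuous dp); exact: nbhsx_ballx.
have nP : nbhs p P.
  apply: filterI => //; apply: (@filter_forall _ (ogrp c)
    (fun g x => if G g then near_p (oact g x) else oact g x <> x) _ (nbhs_filter p)).
  move=> g; case Gg : (G g).
    by apply: (@act_cont g p near_p); rewrite GP.
  apply: near_neq; [exact: mspace_hausdorff|exact: act_cont|exact: cvg_id|].
  by move=> /asboolP gp; have : G g by []; rewrite Gg.
pose O := P°; have oO : open O by exact: open_interior.
have Op : O p by [].
have OP x : O x -> P x by exact: interior_subset.
have oFO (O' : set (ocov c)) : open O' -> O' `<=` O -> open ((F \o chi) @` O').
  move=> oO' O'O; rewrite -image_comp; apply: (near_id_open nF).
    by apply: cmap_open => // x /O'O /OP [[]].
  by move=> _ [x /O'O /OP [[]]] _ ? _ <-.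
have : nbhs (0 : 'rV[R]_n) ((F \o chi) @` O).
  by apply: open_nbhs_nbhs; split; [exact: oFO|exists p].
move=> /nbhs_ballP[e /= e0 eO].
have cF x : O x -> {for x, continuous (F \o chi)}.
  move=> /OP [[dx ax] _]; apply: continuous_comp; first exact: cmap_continuous.
  exact: near_id_continuous nF _ ax.
(* Restricting to the preimage of a ball makes the image of the new chart exactly that ball. *)
pose U := O `&` (F \o chi) @^-1` (ball 0 e).
have oU : open U by apply: open_setI_preimage => //; exact: ball_open.
have injU x y : U x -> U y -> (F \o chi) x = (F \o chi) y -> x = y.
  move=> [/OP [[dx ax] _] _] [/OP [[dy ay] _] _] E.
  by apply: (cmap_inj dx dy); exact: near_id_inj nF _ _ ax ay E.
have cU x : U x -> {for x, continuous (F \o chi)} by move=> [/cF].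
have opU O' : open O' -> O' `<=` U -> open ((F \o chi) @` O').
  by move=> oO' O'U; apply: oFO => // x /O'U [].
exists (CoordChart oU injU cU opU), F; split=> //=.
- by split=> //; split=> //; rewrite /= -/a F0; exact: ballxx.
- exists e => //; apply/seteqP; split=> [_ [x [_ ?] <-]//|y ye].
  have [x Ox Ex] := eO _ ye; exists x => //; split=> //=.
  by move: ye; rewrite -Ex.
- by split=> // x [/OP [[]]].
(* Both [x] and its translate lie where [F \o chi] is injective, so [g] fixes [x] iff [J g] fixes
   the coordinates of [x]. *)
- move=> g gp; exists (J g - 1%:M) => x [/OP [[dx ax] Px] _].
  have Gg : G g by apply/asboolP.
  have PG h : G h -> near_p (oact h x) by move=> Gh; have := Px h; case: (G h) Gh.
  have E : F (chi (oact g x)) = F (chi x) *m J g.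
    apply: F_act => //; first exact: (PG g Gg).1.
      by move=> h Gh; rewrite -oactM; apply: (PG _ _).1; rewrite GM.
    by move=> h Gh; exact: (PG _ _).1.
  rewrite mulmxBr mulmx1 /= -E; split=> [->|/eqP]; first by rewrite subrr.
  rewrite subr_eq0 => /eqP FE'; apply: (cmap_inj (PG g Gg).1 dx).
  exact: near_id_inj nF _ _ (PG g Gg).2 ax FE'.
- move=> g gp x [/OP [_ Px] _]; have := Px g.
  by case Gg : (G g) => // _; case: gp; exact: GP.
Qed.
End AtPoint.

Lemma linearization n (X : topologicalType) (c : orb_chart R n X) (p : ocov c) :
  exists (phi chi : coord_chart R n (ocov c)) (F : 'rV[R]_n -> 'rV[R]_n),
  [/\ cdom phi p /\ phi p = 0,
      exists2 e, 0 < e & phi @` cdom phi = ball 0 e,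
      [/\ matlas chi /\ cdom phi `<=` cdom chi, forall x, phi x = F (chi x) &
          strict_diff F (chi p) id],
      forall g : ogrp c, oact g p = p -> exists K : 'M[R]_n,
        forall x, cdom phi x -> oact g x = x <-> phi x *m K = 0 &
      forall g : ogrp c, oact g p <> p -> forall x, cdom phi x -> oact g x <> x].
Proof.
have [chi achi dp] := matlas_cover p.
have [r rP] := choice (fun g => (oact_smooth (o := c) g).2 chi chi achi achi).
have [phi [F [? ? [? ? ?] ? ?]]] := linearization_at dp rP.
by exists phi, chi, F; split.
Qed.
End Linearization.

(** * Rigidity of effective actions; openness of equidimensional immersions *)

Section Rigidity.
Variable R : realType.

Lemma open_subset_ker n k (B : set 'rV[R]_n) (K : 'M[R]_(n, k)) :
  open B -> B !=set0 -> (forall v, B v -> v *m K = 0) -> K = 0.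
Proof.
move=> oB [v Bv] BK; have : nbhs v B by exact: open_nbhs_nbhs.
move=> /nbhs_ballP[e /= e0 vB]; apply/row_matrixP => i; rewrite row0 rowE.
have e2 : 0 < e / 2 by rewrite divr_gt0.
have /BK : B (v + (e / 2) *: delta_mx 0 i).
  apply: vB; rewrite -ball_normE /= opprD addrA subrr sub0r normrN normrZ.
  have d1 : `|delta_mx 0 i : 'rV[R]_n| <= 1.
    apply: mx_norm_le => // j l; rewrite mxE.
    by case: (_ && _); rewrite ?normr1 ?normr0.
  apply: le_lt_trans (ler_wpM2l (normr_ge0 _) d1) _.
  by rewrite mulr1 gtr0_norm//; lra.
rewrite mulmxDl BK// add0r -scalemxAl => /eqP.
by rewrite scaler_eq0 gt_eqF//= => /eqP.
Qed.

(** The interior of the fixed set is also closed: in linear coordinates at a limit point, the fixed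
    points form a linear subspace containing a nonempty open set, hence everything. Connectedness of
    the chart and effectiveness conclude. *)
Lemma fix_open_eq1 n (X : topologicalType) (c : orb_chart R n X) (h : ogrp c) O :
  open O -> O !=set0 -> (forall x, O x -> oact h x = x) -> h = 1%g.
Proof.
move=> oO [x0 Ox0] fixO; pose A := (@fixed_set R n X c h)°.
have oA : open A by exact: open_interior.
have clA : closed A.
  move=> p Ap; have [phi [_ [_ [[dp _] _ _ KP nK]]]] := linearization p.
  have np : nbhs p (cdom phi).
    by apply: open_nbhs_nbhs; split=> //; exact: cdom_open.
  have [x [Ax dx]] := Ap _ np.
  have hp : oact h p = p.
    (* Otherwise [h] would move every point of the chart, including [x]. *)
    by apply: contrapT => /nK /(_ x dx); apply; exact: interior_subset Ax.
  have [K fixK] := KP h hp.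
  have K0 : K = 0.
    apply: (@open_subset_ker _ _ (phi @` (A `&` cdom phi))).
    - by apply: cmap_open; [apply: openI => //; exact: cdom_open|move=> y []].
    - by exists (phi x), x.
    - by move=> _ [y [Ay dy] <-]; apply/fixK => //; exact: interior_subset Ay.
  by apply: filterS np => y dy; apply/fixK; rewrite ?K0 ?mulmx0.
have AT : A = setT.
  apply: (@ocov_connected _ _ _ c); first exists x0.
  - by apply: filterS (open_nbhs_nbhs (conj oO Ox0)) => x /fixO.
  - by exists A => //; rewrite setTI.
  - by exists A => //; rewrite setTI.
apply: oact_effective => p.
by have /interior_subset : A p by rewrite AT.
Qed.

(** In equal dimensions the injective differential [J] is invertible. Composed with its inverse, the
    local representative becomes strictly tangent to the identity, hence open near the point. *)
Lemma immersion_open n (M N : manifold R n) (l : M -> N) (O : set M) :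
  immersion l -> open O -> open (l @` O).
Proof.
move=> [[cl sl] il] oO; rewrite openE => _ [x Ox <-].
have [phi aphi dx] := matlas_cover x; have [psi apsi ex] := matlas_cover (l x).
have [r rP] := sl _ _ aphi apsi.
have [_ sr] := local_rep_class cl rP dx ex.
set J := jac r (phi x).
have uJ : J \in unitmx.
  rewrite -row_free_unit -kermx_eq0; apply/eqP/row_matrixP => i; rewrite row0.
  apply: (il _ _ _ aphi apsi rP x dx ex).
  by rewrite -!diff_jac -row_mul mulmx_ker row0 mul0mx.
pose L : 'rV[R]_n -> 'rV[R]_n := mulmxr (invmx J).
have cL : continuous L by exact: mulmxr_continuous.
have sF : strict_diff (L \o r) (phi x) id.
  have -> : id = L \o 'd r (phi x).
    by apply/funext => w; rewrite /L /= -diff_jac mulmxK.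
  exact: strict_diff_lin.
have [d d0 nF] := strict_diff_id sF.
pose O1 := O `&` (cdom phi `&` l @^-1` cdom psi).
have oO1 : open O1.
  apply: openI => //; apply: openI; first exact: cdom_open.
  by apply: open_comp; [move=> y _; exact: cl|exact: cdom_open].
pose O2 := O1 `&` phi @^-1` ball (phi x) d.
have oO2 : open O2.
  apply: open_setI_preimage => //; last exact: ball_open.
  by move=> y [_ [dy _]]; exact: cmap_continuous.
have oF : open ((L \o r) @` (phi @` O2)).
  apply: (near_id_open nF); last by move=> _ [y [_ ?] <-].
  by apply: cmap_open => // y [[_ []]].
have oW : open (cdom psi `&` (L \o psi) @^-1` ((L \o r) @` (phi @` O2))).
  apply: open_setI_preimage; [exact: cdom_open| |exact: oF].
  move=> y ey; apply: continuous_comp; first exact: (cmap_continuous ey).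
  exact: cL.
apply: (@filterS _ _ (nbhs_filter (l x)) _ _ _ (open_nbhs_nbhs (conj oW _))).
  move=> y [ey [_ [z [[Oz [dz ez]] _] <-]]] /= E.
  exists z => //; apply: (cmap_inj ez ey); rewrite -rP.2//.
  exact: (can_inj (mulmxKV uJ)) E.
split=> //=; exists (phi x); last by rewrite rP.2.
by exists x => //; split=> //; exact: ballxx.
Qed.
End Rigidity.

(** * Invariance of trivial stabilizers under change of chart *)

Section Isotropy.
Variables (R : realType) (n : nat) (X : topologicalType).
Variables (e d : orb_chart R n X) (l : ocov e -> ocov d).
Hypothesis il : orb_injection l.

Let cl : continuous l. Proof. by case: il => _ [[[]]]. Qed.
Let jl : injective l. Proof. by case: il => _ []. Qed.
Let projl p : oproj d (l p) = oproj e p. Proof. by case: il. Qed.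
Let act_cont (c : orb_chart R n X) (g : ogrp c) : continuous (oact g) :=
  (oact_smooth g).1.

(** If [h] fixes [r], then [l (oact h s)] is always some [oact g (l s)]. The finitely many [g] other
    than 1 move [l r], so continuity excludes them for [s] near [r]. Hence [h] fixes a neighbourhood
    of [r], and rigidity applies. *)
Lemma injection_trivial_stabilizer r : trivial_stabilizer (l r) -> trivial_stabilizer r.
Proof.
move=> tl h hr.
have : \forall s \near r, forall g : ogrp d, g != 1%g -> oact g (l s) <> l (oact h s).
  apply: filter_forall => g; case: (eqVneq g 1%g) => [_|g1]; first exact: nearW.
  suff H : \forall s \near r, oact g (l s) <> l (oact h s) by apply: filterS H.
  apply: (@near_neq _ _ (oact g \o l) (l \o oact h)).
  - exact: mspace_hausdorff.
  - by apply: continuous_comp; [exact: cl|exact: act_cont].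
  - by apply: continuous_comp; [exact: act_cont|exact: cl].
  - by rewrite /= hr => /tl E; rewrite E eqxx in g1.
rewrite -nbhs_nearE; move=> /nbhs_interior nr.
apply: (@fix_open_eq1 _ _ _ e h _ (open_interior _)).
  by exists r; exact: nbhs_singleton nr.
move=> s /interior_subset ns; apply: jl.
have /oproj_orbit [g E] : oproj d (l s) = oproj d (l (oact h s)).
  by rewrite !projl; apply/oproj_orbit; exists h.
have [g1|/ns] := eqVneq g 1%g; first by rewrite E g1 oact1.
by rewrite E.
Qed.

(** Mirror image of the previous argument. Openness of [range l] ensures that [oact h (l s)] comes
    from [e] for [s] near [r]. *)
Lemma trivial_stabilizer_injection r : trivial_stabilizer r -> trivial_stabilizer (l r).
Proof.
move=> tr h hr.
have ol (O : set (ocov e)) : open O -> open (l @` O).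
  by apply: immersion_open; case: il => _ [].
have : \forall s \near r, forall k : ogrp e, k != 1%g -> l (oact k s) <> oact h (l s).
  apply: filter_forall => k; case: (eqVneq k 1%g) => [_|k1]; first exact: nearW.
  suff H : \forall s \near r, l (oact k s) <> oact h (l s) by apply: filterS H.
  apply: (@near_neq _ _ (l \o oact k) (oact h \o l)).
  - exact: mspace_hausdorff.
  - by apply: continuous_comp; [exact: act_cont|exact: cl].
  - by apply: continuous_comp; [exact: cl|exact: act_cont].
  - by rewrite /= hr => /jl /tr E; rewrite E eqxx in k1.
have : \forall s \near r, range l (oact h (l s)).
  have nh : nbhs (oact h (l r)) (range l).
    by rewrite hr; apply: open_nbhs_nbhs; split; [exact/ol/openT|exists r].
  exact: (cl (act_cont nh)).
move=> n1 n2; have /nbhs_interior nr := @filterI _ _ (nbhs_filter r) _ _ n1 n2.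
apply: (@fix_open_eq1 _ _ _ d h _ (ol _ (open_interior _))).
  by exists (l r), r => //; exact: nbhs_singleton nr.
move=> _ [s /interior_subset [[s' _ Es'] ns] <-].
have /oproj_orbit [k E] : oproj e s = oproj e s'.
  by rewrite -!projl Es'; apply/oproj_orbit; exists h.
have [k1|/ns] := eqVneq k 1%g; last by rewrite -E Es'.
by rewrite -Es' E k1 oact1.
Qed.
End Isotropy.

Lemma trivial_stabilizer_orbit (R : realType) n (X : topologicalType)
    (c : orb_chart R n X) (p : ocov c) g :
  trivial_stabilizer p -> trivial_stabilizer (oact g p).
Proof.
move=> tp h hp; have /tp : oact (g^-1 * h * g)%g p = p.
  by rewrite !oactM hp -oactM mulVg oact1.
move=> /(congr1 (fun k => g * k * g^-1)%g).
by rewrite !mulgA mulgV mul1g mulg1 mulgK mulgV.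
Qed.

(** The chart witnessing regularity and [c] have a common refinement [e]. Triviality passes down to
    [e], then up to [c], and along orbits, since two lifts of one point lie in one orbit. *)
Lemma regular_trivial_stabilizer (R : realType) n (X : orbifold R n)
    (c : orb_chart R n X) (p : ocov c) :
  oatlas c -> regular_points X (oproj c p) -> trivial_stabilizer p.
Proof.
move=> Ac [c' [p' [Ac' Ep tp']]].
have cp : odom c (oproj c p) by rewrite -oproj_range; exists p.
have cp' : odom c' (oproj c p) by rewrite -Ep -oproj_range; exists p'.
have [e [ep _ [l il] [l' il']]] := (oatlas_atlas X).1 _ _ Ac Ac' _ cp cp'.
move: ep; rewrite -oproj_range => -[r _ Er].
have /oproj_orbit [g Eg] : oproj c' p' = oproj c' (l' r).
  by case: il' => _ _ ->; rewrite Er.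
have tr : trivial_stabilizer r.
  apply: (injection_trivial_stabilizer il').
  by rewrite Eg; exact: trivial_stabilizer_orbit.
have /oproj_orbit [k ->] : oproj c (l r) = oproj c p by case: il => _ _ ->.
apply: trivial_stabilizer_orbit.
exact: (trivial_stabilizer_injection il).
Qed.

(** * Dimension of fixed sets *)

Section FixedSets.
Variable R : realType.

Lemma chart_inverse n (M : topologicalType) (phi : coord_chart R n M) (p : M) :
  exists s : 'rV[R]_n -> M, forall x, cdom phi x ->
    s (phi x) = x /\ {for phi x, continuous s}.
Proof.
(* [p] is the default value off the image of the chart. *)
have H y : exists x, (phi @` cdom phi) y -> cdom phi x /\ phi x = y.
  have [[x dx E]|nx] := pselect ((phi @` cdom phi) y); first by exists x.
  by exists p => /nx.
have [s sP] := choice H.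
have sK x : cdom phi x -> s (phi x) = x.
  move=> dx; have [|ds E] := sP (phi x); first by exists x.
  exact: cmap_inj E.
exists s => x dx; split; first exact: sK.
move=> O; rewrite (sK _ dx) => /nbhs_interior nO.
pose O' := O° `&` cdom phi.
have oO : open (phi @` O').
  apply: cmap_open; last by move=> y [].
  by apply: openI; [exact: open_interior|exact: cdom_open].
have Ox : (phi @` O') (phi x).
  by exists x => //; split=> //; exact: nbhs_singleton nO.
apply: (@filterS _ _ (nbhs_filter (phi x)) _ _ _ (open_nbhs_nbhs (conj oO Ox))).
by move=> _ [y [Oy dy] <-]; rewrite /= sK//; exact: interior_subset.
Qed.

Lemma strict_diff_comp_id (V W : normedModType R) (f : V -> W) (g : W -> W) a
    (L : {linear V -> W}) : continuous L ->
  strict_diff f a L -> strict_diff g (f a) id -> strict_diff (g \o f) a L.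
Proof.
move=> /linear_lipschitz[k k0 Lk] sf sg e e0.
have k1 : 0 < k + 1 by rewrite addr_gt0.
(* Near [a], [f] is Lipschitz with constant [k + 1]: [k] comes from [L], and 1 from the cap on [e2].
   The error of [g] then has factor [e1 * (k + 1) = e / 2]. *)
pose e1 := e / 2 / (k + 1).
have e10 : 0 < e1 by rewrite !divr_gt0.
have [d d0 H] := sg _ e10.
pose e2 := Num.min (e / 2) 1.
have e20 : 0 < e2 by rewrite lt_min ltr01 divr_gt0.
have [d' d'0 H'] := sf _ e20.
have lip u v : ball a d' u -> ball a d' v -> `|f u - f v| <= (k + 1) * `|u - v|.
  move=> au av; rewrite -[f u - f v](subrK (L (u - v))) mulrDl addrC.
  apply: le_trans (ler_normD _ _) _; apply: lerD; first exact: Lk.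
  apply: le_trans (H' u v au av) _; apply: ler_wpM2r => //.
  by rewrite ge_min lexx orbT.
exists (Num.min d' (d / (k + 1))) => [|u v au av].
  by rewrite lt_min d'0 divr_gt0.
have sub x : ball a (Num.min d' (d / (k + 1))) x -> ball a d' x /\ ball (f a) d (f x).
  move=> ax; have ax' : ball a d' x by apply: le_ball ax; rewrite ge_min lexx.
  split=> //; move: ax; rewrite -!ball_normE /= lt_min => /andP[_ ax].
  apply: le_lt_trans (lip _ _ (ballxx a d'0) ax') _.
  by rewrite mulrC -ltr_pdivlMr.
have [au' fu] := sub _ au; have [av' fv] := sub _ av.
have -> : (g \o f) u - (g \o f) v - L (u - v) =
  (g (f u) - g (f v) - (f u - f v)) + (f u - f v - L (u - v)).
  by rewrite addrA subrK.
apply: le_trans (ler_normD _ _) _; rewrite [e]splitr mulrDl; apply: lerD.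
  apply: le_trans (H _ _ fu fv) _.
  apply: le_trans (ler_wpM2l (ltW e10) (lip _ _ au' av')) _.
  by rewrite mulrA /e1 divfK// gt_eqF.
apply: le_trans (H' _ _ au' av') _; apply: ler_wpM2r => //.
by rewrite ge_min lexx.
Qed.

Lemma small_eq0 (V : normedModType R) (v : V) (k : R) : 0 <= k ->
  (forall e, 0 < e -> e <= 1 -> `|v| <= e * k) -> v = 0.
Proof.
move=> k0 H; apply/eqP; rewrite -normr_eq0; apply: contrapT => /negP v0.
have vp : 0 < `|v| by rewrite lt_neqAle eq_sym v0 normr_ge0.
pose e := Num.min 1 (`|v| / (2 * (k + 1))).
have k1 : 0 < k + 1 by rewrite ltr_wpDl.
have e0 : 0 < e by rewrite lt_min ltr01 divr_gt0// mulr_gt0.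
have e1 : e <= 1 by rewrite ge_min lexx.
have ev : e <= `|v| / (2 * (k + 1)) by rewrite ge_min lexx orbT.
have := H e e0 e1; apply/negP; rewrite -ltNge.
apply: (@le_lt_trans _ _ (`|v| / 2)); last by move: vp; lra.
apply: (@le_trans _ _ (e * (k + 1))); first by apply: ler_wpM2l; [exact: ltW|rewrite lerDl].
by move: ev; rewrite invfM mulrA ler_pdivlMr.
Qed.

Section TangentSpace.
Variables (k n : nat) (X : topologicalType) (c : orb_chart R n X) (p : ocov c).
Variables (phi chi : coord_chart R n (ocov c)) (F : 'rV[R]_n -> 'rV[R]_n) (eps : R).
Hypotheses (dp : cdom phi p) (phip : phi p = 0) (eps0 : 0 < eps).
Hypothesis phiB : phi @` cdom phi = ball 0 eps.
Hypotheses (achi : matlas chi) (sub_chi : cdom phi `<=` cdom chi).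
Hypotheses (phiE : forall x, phi x = F (chi x)) (sF : strict_diff F (chi p) id).
Variables (g : ogrp c) (K : 'M[R]_n).
Hypothesis fixK : forall x, cdom phi x -> oact g x = x <-> phi x *m K = 0.

(** In linear coordinates [g] fixes the segment along [e]. Pulled back by the chart it is a
    connected set through [p], so it stays in the component of [p]. *)
Lemma fixed_curve (e : 'rV[R]_n) : e *m K = 0 ->
  exists (gam : R -> ocov c) (tau : R),
  [/\ 0 < tau, gam 0 = p, {for (0 : R), continuous gam} &
      forall t : R, t \in `[0, tau]%R ->
        connected_component (fixed_set g) p (gam t) /\ phi (gam t) = t *: e].
Proof.
move=> eK; have [s sP] := chart_inverse phi p.
(* Up to [tau] the segment has length at most [eps / 2], so it stays in the image of [phi]. *)
pose tau := eps / (`|e| + 1) / 2.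
have e1 : 0 < `|e| + 1 by rewrite ltr_wpDl.
have tau0 : 0 < tau by rewrite !divr_gt0.
have inB (t : R) : t \in `[0, tau]%R -> exists2 x, cdom phi x & phi x = t *: e.
  rewrite in_itv /= => /andP[t0 tt].
  suff : (phi @` cdom phi) (t *: e) by [].
  rewrite phiB -ball_normE /= sub0r normrN normrZ ger0_norm//.
  apply: (@le_lt_trans _ _ (tau * (`|e| + 1))).
    by apply: ler_pM => //; rewrite lerDl.
  by rewrite /tau mulrAC divfK ?gt_eqF//; move: eps0; lra.
have gc (t : R) : t \in `[0, tau]%R -> {for t, continuous (fun t : R => s (t *: e))}.
  move=> /inB[x dx E]; apply: (@continuous_comp _ _ _ (fun t : R => t *: e) s).
    exact: scalel_continuous.
  by rewrite -E; exact: (sP _ dx).2.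
have t00 : (0 : R) \in `[0, tau]%R by rewrite in_itv /= lexx ltW.
have g0 : s (0 *: e) = p by rewrite scale0r -phip; exact: (sP _ dp).1.
exists (fun t : R => s (t *: e)), tau; split=> //; first exact: gc.
move=> t tI; split; last by have [x dx <-] := inB t tI; rewrite (sP _ dx).1.
exists ((fun t : R => s (t *: e)) @` `[0, tau]); last by exists t.
split; first by exists 0.
- move=> _ [u uI <-]; have [x dx E] := inB u uI.
  rewrite -E (sP _ dx).1 /fixed_set /=; apply/fixK => //.
  by rewrite E -scalemxAl eK scaler0.
- apply: connected_continuous_connected; first exact: segment_connected.
  by apply: continuous_in_subspaceT => u /set_mem uI; exact: gc.
Qed.

(** Every [e] in the kernel of [K] is tangent to the component: the curve of [fixed_curve] runs in
    the image of [i], and comparing it with the differential [J] of [i] puts [e] in the row space of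
    [J], of rank at most [k]. *)
Lemma fixed_set_rank :
  submanifold k (connected_component (fixed_set g) p) -> (\rank (kermx K) <= k)%N.
Proof.
move=> [V [i [[[[ci si] ii] ji ti] rangei]]].
have gp : oact g p = p by apply/fixK => //; rewrite phip mul0mx.
have : connected_component (fixed_set g) p p by exact: connected_component_refl.
rewrite -rangei => -[v0 _ iv0].
have [psi apsi dv0] := matlas_cover v0.
have [r rP] := si _ _ apsi achi.
have dchi : cdom chi (i v0) by rewrite iv0; exact: sub_chi.
have [_ sr] := local_rep_class ci rP dv0 dchi.
pose a0 := psi v0; pose J := jac r a0.
have ra0 : r a0 = chi p by rewrite rP.2// iv0.
have fJ : row_free J.
  rewrite -kermx_eq0; apply/eqP/row_matrixP => j; rewrite row0.
  apply: (ii _ _ _ apsi achi rP v0 dv0 dchi).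
  by rewrite -!diff_jac -row_mul mulmx_ker row0 mul0mx.
have sPhi : strict_diff (F \o r) a0 (mulmxr J).
  apply: strict_diff_comp_id; [exact: mulmxr_continuous| |by rewrite ra0].
  move=> e e0; have [d d0 H] := sr e e0; exists d => // u v du dv.
  by have := H u v du dv; rewrite -diff_jac.
apply: leq_trans (rank_leq_row J); apply: mxrankS; apply/rV_subP => e /sub_kermxP eK.
rewrite submxE; apply/eqP.
have [gam [tau [tau0 gam0 cgam gamP]]] := fixed_curve eK.
have [b b0 Bb] := linear_lipschitz (@mulmxr_continuous R _ _ (pinvmx J)).
have [q q0 Qq] := linear_lipschitz (@mulmxr_continuous R _ _ (cokermx J)).
apply: (@small_eq0 _ _ (q * `|e|)) => [|eta eta0 eta1]; first by rewrite mulr_ge0// ltW.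
(* Then [b * ep] is [eta / 2], at most one half, so that the error term in [w] can be absorbed when
   [w] is bounded. *)
pose ep := eta / (2 * b).
have ep0 : 0 < ep by rewrite divr_gt0// mulr_gt0.
have [d d0 H] := sPhi _ ep0.
pose O := (cdom psi `&` i @^-1` cdom chi) `&` psi @^-1` ball a0 d.
have oO : open O.
  apply: open_setI_preimage; last exact: ball_open.
    apply: openI; first exact: cdom_open.
    by apply: open_comp; [move=> y _; exact: ci|exact: cdom_open].
  by move=> y [dy _]; exact: cmap_continuous.
(* [i] induces the subspace topology, so points of the curve close to [p] come from points of
   [O]. *)
have [Om oOm EO] := ti _ oO.
have Omp : Om p.
  rewrite -iv0; suff : (i @^-1` Om) v0 by [].
  by rewrite -EO; split=> //; exact: ballxx.
have : \forall t \near (0 : R), Om (gam t).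
  by apply: cgam; rewrite gam0; exact: open_nbhs_nbhs.
move=> /nbhs_ballP[s /= s0 sOm].
pose t := Num.min tau (s / 2).
have t0 : 0 < t by rewrite lt_min tau0 divr_gt0.
have lt_ts : t < s by rewrite gt_min; apply/orP; right; lra.
have Omt : Om (gam t) by apply: sOm; rewrite -ball_normE /= sub0r normrN gtr0_norm.
have [|Ct gE] := gamP t; first by rewrite in_itv /= ltW//= ge_min lexx.
move: Ct; rewrite -rangei => -[v _ iv].
have [[dv dv'] av] : O v by rewrite EO /= iv.
pose w := psi v - a0.
have Ew : `|t *: e - w *m J| <= ep * `|w|.
  have := H _ _ av (ballxx a0 d0).
  rewrite /= (rP.2 v)// iv -phiE gE ra0 -phiE phip subr0.
  by apply.
(* [J] is row free, so [pinvmx J] is a right inverse of it. *)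
have wB : `|w| <= b * `|w *m J|.
  by have := Bb (w *m J); rewrite /= mulmxKp.
have wt : `|w| <= 2 * b * (t * `|e|).
  have H1 : `|w *m J| <= t * `|e| + ep * `|w|.
    have -> : w *m J = t *: e - (t *: e - w *m J) by rewrite subKr.
    by apply: le_trans (ler_normB _ _) _; rewrite normrZ gtr0_norm// lerD2l.
  have H2 : b * (ep * `|w|) <= `|w| / 2.
    rewrite mulrA /ep [b * _]mulrC invfM mulrA divfK ?gt_eqF//.
    by rewrite mulrAC -mulrA ler_piMl// divr_ge0.
  have := ler_wpM2l (ltW b0) H1; rewrite mulrDr.
  by move: H2 wB; lra.
have : `|t *: (e *m cokermx J)| <= t * (eta * (q * `|e|)).
  (* [cokermx J] kills [w *m J] and leaves only the error term. *)
  have -> : t *: (e *m cokermx J) = (t *: e - w *m J) *m cokermx J.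
    by rewrite mulmxBl -scalemxAl -mulmxA mulmx_coker mulmx0 subr0.
  apply: le_trans (Qq _) _.
  apply: le_trans (ler_wpM2l (ltW q0) Ew) _.
  apply: le_trans (ler_wpM2l (ltW q0) (ler_wpM2l (ltW ep0) wt)) _.
  rewrite [ep * _]mulrA /ep divfK ?gt_eqF ?mulr_gt0//.
  by rewrite le_eqVlt; apply/orP; left; apply/eqP; ring.
by rewrite normrZ gtr0_norm// ler_pM2l.
Qed.
End TangentSpace.
End FixedSets.

(** * Complements of linear subspaces and connectedness *)

Section Complement.
Variables (R : realType) (n : nat).

(** The kernels are removed one at a time: each is closed, and the kernel of a nonzero matrix
    contains no nonempty open set. *)
Lemma open_avoid_kernels (I : finType) (P : pred I) (K : I -> 'M[R]_n) (O : set 'rV[R]_n) :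
  (forall i, P i -> K i <> 0) -> open O -> O !=set0 ->
  exists2 v, O v & forall i, P i -> v *m K i <> 0.
Proof.
move=> K0 oO O0.
suff [U [_ [v Uv] UO UK]] : exists U : set 'rV[R]_n, [/\ open U, U !=set0, U `<=` O &
    forall v, U v -> forall i, i \in enum P -> v *m K i <> 0].
  by exists v => [|i Pi]; [exact: UO|apply: UK; rewrite ?mem_enum].
have : forall i, i \in enum P -> K i <> 0 by move=> i; rewrite mem_enum; exact: K0.
elim: (enum P) => [_|i s IH Ks]; first by exists O; split.
have [j js|U [oU [v0 Uv0] UO UK]] := IH; first by apply: Ks; rewrite inE js orbT.
pose A : 'rV[R]_n -> 'rV[R]_n := mulmxr (K i).
have oA : open (U `&` A @^-1` ~` [set 0]).
  apply: open_setI_preimage; [exact: oU|by move=> v _; exact: mulmxr_continuous|].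
  by apply: closed_openC; apply: accessible_closed_set1; apply: hausdorff_accessible;
    exact: norm_hausdorff.
exists (U `&` A @^-1` ~` [set 0]); split=> //.
- apply: contrapT => nU; apply: (Ks i); first by rewrite inE eqxx.
  apply: (open_subset_ker oU) => [|v Uv]; first by exists v0.
  by apply: contrapT => vK; apply: nU; exists v.
- by move=> v [/UO].
- move=> v [Uv vK] j; rewrite inE => /orP[/eqP ->//|js].
  exact: UK.
Qed.

Lemma connected_pairwise (T : topologicalType) (Q : set T) :
  (forall x y, Q x -> Q y -> exists C, [/\ connected C, C x, C y & C `<=` Q]) ->
  connected Q.
Proof.
move=> H; have [->|/set0P[x Qx]] := eqVneq Q set0; first exact: connected0.
have -> : Q = connected_component Q x; last exact: component_connected.
apply/seteqP; split=> [y Qy|]; last exact: connected_component_sub.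
by have [C [? ? ? ?]] := H x y Qx Qy; exists C.
Qed.

Lemma segment_image_connected (x y : 'rV[R]_n) :
  connected [set x + t *: (y - x) | t in `[(0 : R), 1]].
Proof.
apply: connected_continuous_connected; first exact: segment_connected.
apply: continuous_subspaceT => t.
by apply: cvgD; [exact: cvg_cst|exact: scalel_continuous].
Qed.

Variables (I : finType) (P : pred I) (K : I -> 'M[R]_n).
Hypothesis codimK : forall i, P i -> (\rank (kermx (K i)) + 2 <= n)%N.
Variable e : R.
Hypothesis e0 : 0 < e.

Let Q := [set v : 'rV[R]_n | ball 0 e v /\ forall i, P i -> v *m K i <> 0].

(* Two points are joined through a generic point off the spans of either of them
   with each kernel, which are proper subspaces. *)
Lemma avoid_kernels_connected : connected Q.
Proof.
apply: connected_pairwise => x y [xe xK] [ye yK].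
have xe' : `|x| < e by move: xe; rewrite -ball_normE /= sub0r normrN.
have ye' : `|y| < e by move: ye; rewrite -ball_normE /= sub0r normrN.
pose z (b : bool) : 'rV[R]_n := if b then x else y.
pose S (ib : I * bool) := (kermx (K ib.1) + z ib.2)%MS.
(* Codimension two enters here: a kernel plus the span of one vector is still a proper subspace,
   that is, its [cokermx] is nonzero. *)
have S0 ib : P ib.1 -> cokermx (S ib) <> 0.
  move=> Pi /eqP; rewrite cokermx_eq0 /row_full => /eqP fS.
  have [+ _] := mxrank_adds_leqif (kermx (K ib.1)) (z ib.2).
  rewrite -/(S ib) fS leqNgt => /negP; apply.
  apply: leq_ltn_trans (leq_add (leqnn _) (rank_leq_row _)) _.
  by rewrite addn1 -addn2; exact: codimK.
have B0 : (ball 0 e : set 'rV[R]_n) !=set0 by exists 0; exact: ballxx.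
have oB : open (ball (0 : 'rV[R]_n) e) by exact: ball_open.
have [r re rS] := @open_avoid_kernels _ (fun ib : I * bool => P ib.1)
  (fun ib => cokermx (S ib)) _ S0 oB B0.
have re' : `|r| < e by move: re; rewrite -ball_normE /= sub0r normrN.
have ze b : `|z b| < e by case: b.
have zK b i : P i -> z b *m K i <> 0 by case: b; [exact: xK|exact: yK].
pose seg b := [set z b + t *: (r - z b) | t in `[(0 : R), 1]].
have segQ b : seg b `<=` Q.
  move=> _ [t /= t01 <-]; move: t01; rewrite in_itv /= => /andP[t0 t1]; split.
    rewrite -ball_normE /= sub0r normrN.
    have -> : z b + t *: (r - z b) = t *: r + (1 - t) *: z b.
      by rewrite scalerBr scalerBl scale1r addrCA [in RHS]addrC addrC.
    apply: le_lt_trans (ler_normD _ _) _; rewrite !normrZ ger0_norm// ger0_norm ?subr_ge0//.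
    have [->|t0'] := eqVneq t 0; first by rewrite mul0r add0r subr0 mul1r.
    have tp : 0 < t by rewrite lt_neqAle eq_sym t0'.
    rewrite [ltRHS](_ : e = t * e + (1 - t) * e); last by ring.
    by apply: ltr_leD; [rewrite ltr_pM2l|rewrite ler_wpM2l ?subr_ge0// ltW].
  move=> i Pi; have [->|t0'] := eqVneq t 0; first by rewrite scale0r addr0; exact: zK.
  move=> E; apply: (rS (i, b) Pi); apply/eqP; rewrite -submxE.
  (* Solving for [r] puts it in the sum of the kernel and the span of [z b], against its choice. *)
  have -> : r = t^-1 *: (z b + t *: (r - z b)) + (1 - t^-1) *: z b.
    rewrite scalerDr scalerA mulVf// scale1r scalerBl scale1r.
    by apply/rowP => j; rewrite !mxE; ring.
  apply: addmx_sub_adds; apply: scalemx_sub => //.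
  exact/sub_kermxP.
have segr b : seg b r.
  by exists 1; [rewrite /= in_itv /= lexx ler01|rewrite scale1r addrC subrK].
have segz b : seg b (z b).
  by exists 0; [rewrite /= in_itv /= lexx ler01|rewrite scale0r addr0].
exists (seg true `|` seg false); split.
- by apply: connectedU; [exists r|exact: segment_image_connected..].
- by left; exact: segz true.
- by right; exact: segz false.
- by move=> v [|] /segQ.
Qed.
End Complement.

(** For a nonempty [B] clopen in [S], let [A] consist of the points near which [S] lies in [B]. Each
    local piece of [S] lies in [B] or misses it, and overlapping neighbourhoods share points of [S]
    by density, so [A] is clopen in [T]. *)
Lemma connected_local (T : topologicalType) (S : set T) : connected [set: T] ->
  (forall p, exists U, [/\ open U, U p, connected (S `&` U) & U `<=` closure (S `&` U)]) ->
  connected S.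
Proof.
move=> cT locS B [b Bb] [C oC EC] [D cD ED].
pose A := [set p | exists U, [/\ open U, U p & S `&` U `<=` B]].
have SB p U : open U -> connected (S `&` U) -> U p -> U `<=` closure (S `&` U) ->
    S `&` U `<=` B \/ S `&` U `&` B = set0.
  move=> oU cU Up Ud; have [->|/set0P B0] := eqVneq (S `&` U `&` B) set0; first by right.
  left; rewrite -setIidPl; apply: cU => //.
    by exists C => //; rewrite EC setIA [S `&` U `&` S]setIAC setIid.
  by exists D => //; rewrite ED setIA [S `&` U `&` S]setIAC setIid.
have BS : B `<=` S by rewrite EC; exact: subIsetl.
have oA : open A.
  rewrite openE => p [U [oU Up UB]]; apply: filterS (open_nbhs_nbhs (conj oU Up)) => q Uq.
  by exists U.
have clA : closed A.
  move=> p Ap; have [U [oU Up cU Ud]] := locS p.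
  have [?|U0] := SB p U oU cU Up Ud; first by exists U.
  have [q [[V [oV Vq VB]] Uq]] := Ap U (open_nbhs_nbhs (conj oU Up)).
  have [s [[Ss Us] Vs]] := Ud q Uq V (open_nbhs_nbhs (conj oV Vq)).
  have : (S `&` U `&` B) s by split=> //; apply: VB.
  by rewrite U0.
have Ab : A b.
  have [U [oU Ub cU Ud]] := locS b.
  have [?|U0] := SB b U oU cU Ub Ud; first by exists U.
  have : (S `&` U `&` B) b by split=> //; split=> //; exact: BS.
  by rewrite U0.
have AT : A = setT.
  apply: cT; first by exists b.
    by exists A => //; rewrite setTI.
  by exists A => //; rewrite setTI.
apply/seteqP; split=> // s Ss.
have [U [_ Us]] : A s by rewrite AT.
by apply.
Qed.

(** * The regular points of a chart *)

Section RegularSet.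
Variables (R : realType) (n : nat) (X : orbifold R n).
Hypothesis codimX : singular_codim_ge2 X.
Variable c : orb_chart R n X.
Hypothesis Ac : oatlas c.

(** In linear coordinates at [p], the points with trivial stabilizer are those off the kernels
    attached to the nontrivial elements fixing [p]; the other elements fix nothing there. By
    [fixed_set_rank] these kernels have codimension at least two. *)
Lemma regular_set_local (p : ocov c) : exists U : set (ocov c),
  [/\ open U, U p, connected (@trivial_stabilizer R n X c `&` U) &
      U `<=` closure (@trivial_stabilizer R n X c `&` U)].
Proof.
have [phi [chi [F [[dp phip] [e e0 phiB] [[achi schi] phiE sF] KP nK]]]] := linearization p.
pose P (g : ogrp c) := (g != 1%g) && `[< oact g p = p >].
have exK g : exists K : 'M[R]_n, oact g p = p ->
    forall x, cdom phi x -> oact g x = x <-> phi x *m K = 0.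
  have [gp|ngp] := pselect (oact g p = p); last by exists 0.
  by have [K HK] := KP g gp; exists K.
have [K KQ] := choice exK.
have codimK g : P g -> (\rank (kermx (K g)) + 2 <= n)%N.
  move=> /andP[/eqP g1 /asboolP gp].
  have [k kn sub] := codimX Ac g1 gp.
  apply: leq_trans kn; rewrite leq_add2r.
  exact: (fixed_set_rank dp phip e0 phiB achi schi phiE sF (KQ g gp) sub).
have K0 g : P g -> K g <> 0.
  (* The zero matrix has a kernel of rank [n], against the codimension bound. *)
  move=> /codimK + E; rewrite E kermx0 mxrank1 addn2 => /ltnW.
  by rewrite ltnn.
pose Q := [set v : 'rV[R]_n | ball 0 e v /\ forall g, P g -> v *m K g <> 0].
have tsP x : cdom phi x -> trivial_stabilizer x <-> Q (phi x).
  move=> dx; split=> [tx|[_ nQ] g gx].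
    split=> [|g /andP[/eqP g1 /asboolP gp]]; first by rewrite -phiB; exists x.
    by move=> /(KQ g gp x dx) /tx.
  have gp : oact g p = p by apply: contrapT => /nK /(_ x dx).
  apply: contrapT => /eqP g1; apply: (nQ g); last exact/(KQ g gp x dx).
  by rewrite /P g1; apply/asboolP.
have [s sP] := chart_inverse phi p.
exists (cdom phi); split; [exact: cdom_open|exact: dp| |].
  have -> : @trivial_stabilizer R n X c `&` cdom phi = s @` Q.
    apply/seteqP; split=> [x [tx dx]|_ [v Qv <-]].
      by exists (phi x); [exact/tsP|exact: (sP x dx).1].
    have : (phi @` cdom phi) v by rewrite phiB; exact: Qv.1.
    move=> [x dx E]; rewrite -E in Qv *; rewrite (sP x dx).1; split=> //.
    exact/tsP.
  apply: connected_continuous_connected; first exact: avoid_kernels_connected.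
  apply: continuous_in_subspaceT => v /set_mem [ve _].
  have : (phi @` cdom phi) v by rewrite phiB.
  by move=> [x dx <-]; exact: (sP x dx).2.
move=> x dx O /nbhs_interior nO.
have oO : open (phi @` (O° `&` cdom phi)).
  apply: cmap_open; last by move=> y [].
  by apply: openI; [exact: open_interior|exact: cdom_open].
have [|_ [y [Oy dy] <-] yK] := open_avoid_kernels K0 oO.
  by exists (phi x), x => //; split=> //; exact: nbhs_singleton nO.
exists y; split; last exact: interior_subset.
by split=> //; apply/tsP => //; split=> //; rewrite -phiB; exists y.
Qed.

Lemma regular_set_connected : connected (@trivial_stabilizer R n X c).
Proof. by apply: connected_local; [exact: ocov_connected|exact: regular_set_local]. Qed.

Lemma regular_set_dense (p : ocov c) : closure (@trivial_stabilizer R n X c) p.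
Proof.
have [U [_ Up _ /(_ p Up)]] := regular_set_local p.
by apply: closureS; exact: subIsetl.
Qed.
End RegularSet.

(** * Graphs of smooth maps between manifolds *)

Section Graphs.
Variable R : realType.

Lemma class_C_sub (V W : normedModType R) k (D E : set V) (f : V -> W) :
  E `<=` D -> class_C k D f -> class_C k E f.
Proof.
move=> ED; elim: k f => [|k IH] f /=; first by move=> cf x /ED; exact: cf.
by move=> [df cf]; split=> [x /ED|v]; [exact: df|exact: IH].
Qed.

Lemma class_C_row_mx m n1 n2 k (D : set 'rV[R]_m) (a : 'rV[R]_m -> 'rV[R]_n1)
    (b : 'rV[R]_m -> 'rV[R]_n2) : open D ->
  class_C k D a -> class_C k D b -> class_C k D (fun x => row_mx (a x) (b x)).
Proof.
move=> oD; elim: k a b => [|k IH] a b /=.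
  move=> ca cb x Dx.
  apply: (@continuous_comp _ _ _ (fun x => (a x, b x)) (@row_pair R n1 n2));
    last exact: row_pair_continuous.
  exact: cvg_pair (ca x Dx) (cb x Dx).
move=> [da Ca] [db Cb].
have dJ z : differentiable (@row_pair R n1 n2) z.
  by apply: linear_differentiable; exact: row_pair_continuous.
have dp x : D x -> differentiable (fun x => (a x, b x)) x.
  by move=> Dx; apply: differentiable_pair; [exact: da|exact: db].
have dab x : D x -> differentiable (@row_pair R n1 n2 \o (fun x => (a x, b x))) x.
  by move=> Dx; apply: differentiable_comp; [exact: dp|exact: dJ].
split=> [x Dx|v]; first exact: dab.
apply: (@class_C_eq _ _ _ _ _ (fun x => row_mx ('D_v a x) ('D_v b x))) => //.
  move=> x Dx.
  have -> : (fun x => row_mx (a x) (b x)) =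
    @row_pair R n1 n2 \o (fun x => (a x, b x)) by [].
  rewrite (deriveE v (dab x Dx)) (diff_comp (dp x Dx) (dJ _)) /=.
  rewrite (diff_lin _ (@row_pair_continuous R n1 n2)).
  rewrite (diff_pair (da x Dx) (db x Dx)) /row_pair /=.
  by rewrite (deriveE v (da x Dx)) (deriveE v (db x Dx)).
exact: IH.
Qed.

Section GraphEmbedding.
Variables (m n : nat) (M : manifold R m) (N : manifold R n) (h : M -> N).
Hypothesis sh : smooth_map h.

Definition graph_map (x : M) : prod_manifold M N := (x, h x).

Lemma graph_map_continuous : continuous graph_map.
Proof. by move=> x; apply: cvg_pair; [exact: cvg_id|exact: sh.1]. Qed.

(** Projection to the first factor is a left inverse: this makes the differential injective, and
    each open [O] is the trace of the cylinder over it. *)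
Lemma graph_map_embedding : smooth_embedding graph_map.
Proof.
have cid : continuous (@id M) by move=> x; exact: cvg_id.
split; last 2 first.
- by move=> x y [].
- move=> O oO; exists (O `*` setT); first by apply: open_setX => //; exact: openT.
  by apply/seteqP; split=> [x Ox|x []].
split.
  split; first exact: graph_map_continuous.
  move=> phi _ aphi [psi1 [psi2 [a1 a2 ->]]].
  have [g1 [s1 E1]] := matlas_compat aphi a1.
  have [g2 [s2 E2]] := sh.2 _ _ aphi a2.
  exists (fun u => row_mx (g1 u) (g2 u)); split=> [k|x dx [/= d1 d2]]; last first.
    by rewrite E1// E2.
  apply: class_C_row_mx.
  - exact: (local_rep_dom_open (psi := prod_chart psi1 psi2) graph_map_continuous).
  - by apply: class_C_sub (s1 k) => _ [x [dx [/= d1 d2]] <-]; exists x.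
  - by apply: class_C_sub (s2 k) => _ [x [dx [/= d1 d2]] <-]; exists x.
move=> phi _ g aphi [psi1 [psi2 [a1 a2 ->]]] rg x dx [/= d1 d2].
have [q rq] := matlas_compat a1 aphi.
have [dg _] := local_rep_class (psi := prod_chart psi1 psi2) graph_map_continuous
  rg dx (conj d1 d2).
have gx : g (phi x) = row_mx (psi1 x) (psi2 (h x)) by rewrite rg.2.
have dq : differentiable (q \o lsubmx) (g (phi x)).
  apply: differentiable_comp; first exact: differentiable_lsubmx.
  by rewrite gx row_mxKl; have [] := local_rep_class cid rq d1 dx.
(* Near [phi x], [q \o lsubmx] undoes [g]: it extracts the [psi1] coordinates and converts them to
   those of [phi]. *)
have E : jac ((q \o lsubmx) \o g) (phi x) = 1%:M.
  rewrite -(jac_id (phi x)); apply: near_eq_jac; last exact: differentiable_comp.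
  have nx : nbhs x (cdom psi1 `&` h @^-1` cdom psi2).
    apply: filterI; first by apply: open_nbhs_nbhs; split=> //; exact: cdom_open.
    by apply: sh.1; apply: open_nbhs_nbhs; split=> //; exact: cdom_open.
  apply: (@filterS _ _ (nbhs_filter (phi x)) _ _ _ (chart_nbhs dx nx)).
  move=> _ [y [[e1 e2] dy] <-] /=.
  by rewrite rg.2//= row_mxKl rq.2.
rewrite (jac_comp dg dq) in E.
move=> u v; rewrite -!diff_jac => /(congr1 (mulmxr (jac (q \o lsubmx) (g (phi x))))).
by rewrite /= -!mulmxA E !mulmx1.
Qed.

Lemma graph_closed : closed (range graph_map).
Proof.
have -> : range graph_map = ~` [set z : M * N | z.2 <> h z.1].
  apply/seteqP; split=> [_ [x _ <-]|[x y] /= /contrapT ->]; first exact.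
  by exists x.
apply: open_closedC; rewrite openE => z /= nz.
apply: (@near_neq (M * N)%type N snd (h \o fst)) => //.
- exact: mspace_hausdorff.
- exact: cvg_snd.
- by apply: continuous_comp; [exact: cvg_fst|exact: sh.1].
Qed.
End GraphEmbedding.
End Graphs.

(** * Suborbifold charts of the graph *)

Section GraphChart.
Variables (R : realType) (m n : nat) (X : orbifold R m) (X' : orbifold R n).
Variable f : X -> X'.

Let Y := [set z : X * X' | z.2 = f z.1].

(** The image of [V] must be the whole part of the graph inside [odom e], so that the pieces cover
    the graph as soon as the chart domains do. *)
Definition graph_cover_chart (e : orb_chart R (m + n) (X * X')%type) (V : set (ocov e)) :=
  [/\ [/\ V !=set0, connected V & closed V],
      exists D : {group ogrp e}, sub_submanifold m D V,
      oproj e @` V = Y `&` odom e &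
      let W := V `&` [set p | trivial_stabilizer p] in
      V `<=` closure W /\ connected W].

Hypothesis codimX : singular_codim_ge2 X.
Hypothesis regf : f @` regular_points X `<=` regular_points X'.

Variables (c : orb_chart R m X) (d : orb_chart R n X').
Hypotheses (Ac : oatlas c) (Ad : oatlas d).
Variables (h : ocov c -> ocov d) (hb : ogrp c -> ogrp d).
Hypothesis sh : smooth_map h.
Hypothesis hbM : {morph hb : g k / (g * k)%g >-> (g * k)%g}.
Hypothesis projh : forall p, oproj d (h p) = f (oproj c p).
Hypothesis acth : forall g p, h (oact g p) = oact (hb g) (h p).

Let e := prod_orb_chart c d.
Let G : ocov c -> ocov e := graph_map h.
Let cG : continuous G := graph_map_continuous sh.

Fact graph_group_set : group_set [set (g, hb g) | g : ogrp c].
Proof.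
have hb1 : hb 1%g = 1%g by apply: (mulgI (hb 1%g)); rewrite -hbM !mulg1.
apply/group_setP; split; first by apply/imsetP; exists 1%g; rewrite ?hb1.
move=> _ _ /imsetP[g _ ->] /imsetP[k _ ->].
by apply/imsetP; exists (g * k)%g => //; rewrite hbM.
Qed.

Lemma graph_sub_submanifold : @sub_submanifold R m _ _ e (Group graph_group_set) (range G).
Proof.
split.
- by exists (ocov c), G; split=> //; exact: graph_map_embedding.
- move=> _ _ /imsetP[g _ ->] [p _ <-]; exists (oact g p) => //.
  by rewrite /G /graph_map acth.
(* [k] may differ from [hb g], but by equivariance both have the same effect on [h p]. *)
- move=> [g k] _ [p _ <-] [q _ [/= Eq Ek]]; exists (g, hb g).
    by apply/imsetP; exists g.
  by rewrite /prod_map /= -acth -Ek Eq.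
Qed.

(** If [(g, k)] fixes [G p], then [g] is trivial by the assumption on [p], and [k] because [h p]
    lies over the regular point [f (oproj c p)]. Conversely, if [g] fixes [p], then [(g, 1)] fixes
    [G p]. *)
Lemma graph_trivial_stabilizer p : trivial_stabilizer p <-> trivial_stabilizer (G p).
Proof.
split=> [tp [g k] [/= /tp -> kp]|tG g gp].
  have /(regular_trivial_stabilizer Ad) th : regular_points X' (oproj d (h p)).
    by apply: regf; exists (oproj c p); [exists c, p|rewrite projh].
  by rewrite (th _ kp).
have /tG [] // : oact ((g, 1%g) : ogrp e) (G p) = G p.
by rewrite /= /prod_map /= gp oact1.
Qed.

Lemma graph_charted : graph_cover_chart (range G).
Proof.
have ctG (A : set (ocov c)) : connected A -> connected (G @` A).
  by move=> cA; apply: connected_continuous_connected cA _; exact: continuous_subspaceT.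
have WE : range G `&` [set p | trivial_stabilizer p] = G @` @trivial_stabilizer R m X c.
  apply/seteqP; split=> [_ [[p _ <-] /graph_trivial_stabilizer tp]|_ [p tp <-]].
    by exists p.
  by split; [exists p|exact/graph_trivial_stabilizer].
split.
- split; [|exact/ctG/ocov_connected|exact: graph_closed].
  by have [p _] := ocov_nonempty c; exists (G p), p.
- by exists (Group graph_group_set); exact: graph_sub_submanifold.
- apply/seteqP; split=> [_ [_ [p _ <-] <-]|[x x'] [Yx [/= cx _]]].
    split; first exact: projh.
    by rewrite /= -!oproj_range; split; [exists p|exists (h p)].
  have -> : x' = f x by exact: Yx.
  move: cx; rewrite -oproj_range => -[p _ <-]; exists (G p); first by exists p.
  by rewrite /= /prod_map /= projh.
- rewrite /= WE; split; last exact/ctG/regular_set_connected.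
  move=> _ [p _ <-] O nO.
  have [q [tq Oq]] := regular_set_dense codimX Ac (cG nO).
  by exists (G q); split=> //; exists q.
Qed.
End GraphChart.

(** * Extraction of a countable atlas and conclusion *)

Section CountableSubatlas.
Variables (R : realType) (n : nat) (Z : orbifold R n).
Variables (Y : set Z) (good : forall e : orb_chart R n Z, set (ocov e) -> Prop).

(** For each member of a countable basis, a chart whose domain contains it is chosen when one
    exists, once among all charts and once among those carrying a good set. The first choices cover
    [Z], the second ones [Y]. *)
Lemma countable_subatlas :
  (forall z, Y z -> exists e V, [/\ oatlas e, odom e z & @good e V]) ->
  exists (I : Type) (c : I -> orb_chart R n Z) (J : set I) (V : forall i, set (ocov (c i))),
    [/\ countable [set: I], forall i, oatlas (c i), forall z, exists i, odom (c i) z,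
        forall z, Y z -> exists2 i, J i & odom (c i) z &
        forall i, J i -> good (V i)].
Proof.
move=> HY; have [B cB [_ bB]] := @ospace_second_countable _ _ Z.
(* The boolean marks the indices required to carry a good chart. *)
pose ok (b : set Z * bool) (e : orb_chart R n Z) :=
  [/\ oatlas e, b.1 `<=` odom e & b.2 -> exists V, @good e V].
pose I := {b : set Z * bool | B b.1 /\ exists e, ok b e}.
have [c cP] := choice (fun i : I => (svalP i).2).
have exV (i : I) : exists V : set (ocov (c i)), (sval i).2 -> good V.
  case: (cP i) => _ _; case: (sval i).2 => [[//|V gV]|_]; last by exists set0.
  by exists V.
pose V (i : I) := projT1 (cid (exV i)).
have sub e z : oatlas e -> odom e z -> forall beta : bool, (beta -> exists V, @good e V) ->
    exists2 i, (sval i).2 = beta & odom (c i) z.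
  move=> Ae ez beta gb.
  have [b [/= Bb bz] be] := bB z _ (open_nbhs_nbhs (conj (odom_open e) ez)).
  have P : B b /\ exists e, ok (b, beta) e by split=> //; exists e; split.
  exists (exist _ (b, beta) P) => //.
  by have [_ + _] := cP (exist _ (b, beta) P); apply.
exists I, c, [set i : I | (sval i).2], V; split.
- have cBT : countable (B `*` [set: bool]) by exact: countableX.
  have [r rinj] := countable_injP _ cBT.
  apply/countable_injP; exists (r \o sval) => -[b Pb] [b' Pb'] _ _ /= E.
  have Eb : b = b' by apply: rinj E; rewrite inE; split=> //; [exact: Pb.1|exact: Pb'.1].
  by subst b'; congr exist; exact: Prop_irrelevance.
- by move=> i; have [] := cP i.
- move=> z; have [e Ae ez] := (oatlas_atlas Z).2 z.
  by have [//|i _ ?] := sub e z Ae ez false; exists i.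
- move=> z /HY [e [V' [Ae ez gV]]].
  by have [_|i ib ?] := sub e z Ae ez true; [exists V'|exists i].
- by move=> i; exact: (projT2 (cid (exV i))).
Qed.
End CountableSubatlas.

Theorem proposition3 (R : realType) (m n : nat) (X : orbifold R m)
    (X' : orbifold R n) (f : X -> X') :
  singular_codim_ge2 X ->
  orb_smooth f ->
  f @` regular_points X `<=` regular_points X' ->
  regular_suborbifold (X := prod_orbifold X X') [set z | z.2 = f z.1].
Proof.
move=> codimX [cf sf] regf.
have [z Yz|I [c [J [V [cI Ac cov covY gV]]]]] := @countable_subatlas R _ (prod_orbifold X X')
    [set z | z.2 = f z.1] (@graph_cover_chart R m n X X' f) _.
  (* Smoothness of [f] at [z.1] provides the lift whose graph is the suborbifold chart around
     [z]. *)
  have [c [d [Ac cz Ad dz [h [hb [sh hbM projh acth]]]]]] := sf z.1.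
  exists (prod_orb_chart c d), (range (graph_map h)); split.
  - by have [_ + _] := prod_oatlasP X X'; apply; exists c, d.
  - by split=> //; rewrite Yz.
  - exact: (graph_charted codimX regf Ac Ad sh hbM projh acth).
(* Indices outside [J] supply charts away from the graph, so that the family is an atlas of the
   whole product; compatibility is inherited from the maximal atlas. *)
exists I, c; split=> //.
  have [cA _] := oatlas_atlas (prod_orbifold X X').
  split=> [_ _ [i ->] [j ->]|z]; first exact: cA.
  by have [i iz] := cov z; exists (c i) => //; exists i.
exists m, J, V; split; last by move=> j /gV [].
split=> [j /gV [[V0 cV clV] subV EV _]|].
  split=> //; exists (odom (c j)) => //; exact: odom_open.
apply/seteqP; split=> [z [j /gV [_ _ EV _]]|z Yz]; first by rewrite EV => -[].
by have [j Jj jz] := covY z Yz; exists j => //; have [_ _ -> _] := gV j Jj.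
Qed.
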